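(* Let $\sigma$ be a function assigning a sign in $\{-,+\}$ to every triple $(i,j,k)$ with $1\le i<j<k\le n$. Then $\sigma$ can be realized by a pseudolinear $x$-monotone drawing of $K_n$ if and only if every $4$-tuple $a<b<c<d$ of indices from $[n]$ is of one of the forms \[{+}{+}{+}{+},\ {+}{+}{+}{-},\ {+}{+}{-}{-},\ {+}{-}{-}{-},\ {-}{-}{-}{-},\ {-}{-}{-}{+},\ {-}{-}{+}{+},\ {-}{+}{+}{+}\] in $\sigma$.
   Context: Drawings as usual; $x$-monotone: every edge meets every vertical line at most once and no two vertices share an $x$-coordinate. A drawing of $K_n$ is pseudolinear if its edges can be extended to unbounded simple curves any two of which cross exactly once (forming an arrangement of pseudolines). Given an $x$-monotone drawing of $K_n$ with vertices $v_1,\dots,v_n$ labelled so that $x(v_1)<\dots<x(v_n)$, its signature function is defined for $i<j<k$ by $\sigma(i,j,k)=-$ if $v_j$ lies above the arc of the edge $v_iv_k$ and $\sigma(i,j,k)=+$ otherwise; $\sigma$ is realized by the drawing if it is its signature function. For $a<b<c<d$, $(a,b,c,d)$ is of the form $\xi_1\xi_2\xi_3\xi_4$ in $\sigma$ if $\sigma(a,b,c)=\xi_1$, $\sigma(a,b,d)=\xi_2$, $\sigma(a,c,d)=\xi_3$, $\sigma(b,c,d)=\xi_4$. *)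

(* Defs.v *)
From HB Require Import structures.
From mathcomp Require Import all_boot all_order all_algebra.
From mathcomp Require Import all_classical all_reals all_analysis.

Set Implicit Arguments.
Unset Strict Implicit.
Unset Printing Implicit Defensive.

Import Order.TTheory GRing.Theory Num.Theory.
Import numFieldNormedType.Exports.

Local Open Scope classical_set_scope.
Local Open Scope ring_scope.

Inductive sign := Plus | Minus.

(* Edges of the complete graph on 'I_n are the pairs (i, j) with i < j; the
   values of functions at other pairs are irrelevant. *)
Definition is_edge (n : nat) (e : 'I_n * 'I_n) : bool := (e.1 < e.2)%N.

(* The curve b passes at time t from one side of A to the other: for some
   neighbourhood U of b t, all points of b shortly before t and shortly after t
   lie in different components of the complement of A in U.  Shrinking U only
   refines the components, so this is a local condition at b t. *)
Definition crosses_at (R : realType) (A : set (R * R)) (b : R -> R * R)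
    (t : R) : Prop :=
  A (b t) /\
  exists U : set (R * R), nbhs (b t) U /\
  exists2 d : R, 0 < d &
    forall s u : R, t - d < s < t -> t < u < t + d ->
      [/\ (U `\` A) (b s), (U `\` A) (b u) &
          ~ connected_component (U `\` A) (b s) (b u)].

(* The arc of an edge is parametrized by `[0, 1]; values outside are
   irrelevant. *)
Record drawing_data (R : realType) (n : nat) := DrawingData {
  vertex : 'I_n -> R * R ;
  arc : 'I_n * 'I_n -> R -> R * R }.

Definition edge_set (R : realType) (n : nat) (D : drawing_data R n)
    (e : 'I_n * 'I_n) : set (R * R) := arc D e @` `[0, 1]%classic.

Definition edge_interior (R : realType) (n : nat) (D : drawing_data R n)
    (e : 'I_n * 'I_n) : set (R * R) := arc D e @` `]0, 1[%classic.

Record is_drawing (R : realType) (n : nat) (D : drawing_data R n) : Prop := {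
  vertices_distinct : injective (vertex D) ;
  arc_continuous : forall e, is_edge e ->
    {within `[0, 1]%classic, continuous (arc D e)} ;
  arc_simple : forall e, is_edge e ->
    {in `[0, 1]%classic &, injective (arc D e)} ;
  arc_endpoints : forall e, is_edge e ->
    arc D e 0 = vertex D e.1 /\ arc D e 1 = vertex D e.2 ;
  arc_avoids_vertices : forall e k, is_edge e ->
    edge_set D e (vertex D k) -> k = e.1 \/ k = e.2 ;
  edges_meet_finitely : forall e f, is_edge e -> is_edge f -> e <> f ->
    finite_set (edge_set D e `&` edge_set D f) ;
  edges_do_not_touch : forall e f (t : R), is_edge e -> is_edge f -> e <> f ->
    0 < t < 1 -> edge_interior D f (arc D e t) ->
    crosses_at (edge_set D f) (arc D e) t ;
  no_triple_point : forall e f g, is_edge e -> is_edge f -> is_edge g ->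
    e <> f -> f <> g -> e <> g ->
    edge_interior D e `&` edge_interior D f `&` edge_interior D g = set0 }.

Definition x_monotone (R : realType) (n : nat) (D : drawing_data R n) : Prop :=
  (forall i j : 'I_n, i <> j -> (vertex D i).1 <> (vertex D j).1) /\
  (forall e, is_edge e -> forall p q : R * R,
     edge_set D e p -> edge_set D e q -> p.1 = q.1 -> p = q).

Definition is_pseudoline (R : realType) (g : R -> R * R) : Prop :=
  [/\ continuous g, injective g,
      `|g t| @[t --> +oo] --> +oo &
      `|g t| @[t --> -oo] --> +oo].

Definition pseudolinear (R : realType) (n : nat) (D : drawing_data R n) : Prop :=
  exists l : 'I_n * 'I_n -> R -> R * R,
    (forall e, is_edge e ->
       is_pseudoline (l e) /\ edge_set D e `<=` range (l e)) /\
    (forall e f, is_edge e -> is_edge f -> e <> f ->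
       exists t : R, crosses_at (range (l f)) (l e) t /\
         forall t' : R, range (l f) (l e t') -> t' = t).

Definition labelled_by_x (R : realType) (n : nat) (D : drawing_data R n) : Prop :=
  forall i j : 'I_n, (i < j)%N -> (vertex D i).1 < (vertex D j).1.

Definition lies_above (R : realType) (p : R * R) (A : set (R * R)) : Prop :=
  exists q : R * R, [/\ A q, q.1 = p.1 & q.2 < p.2].

Definition signature (R : realType) (n : nat) (D : drawing_data R n)
    (i j k : 'I_n) : sign :=
  if `[< lies_above (vertex D j) (edge_set D (i, k)) >] then Minus else Plus.

(* Only the values of sigma at increasing triples are meaningful. *)
Definition realizes (R : realType) (n : nat) (D : drawing_data R n)
    (sigma : 'I_n -> 'I_n -> 'I_n -> sign) : Prop :=
  labelled_by_x D /\
  forall i j k : 'I_n, (i < j)%N -> (j < k)%N ->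
    sigma i j k = signature D i j k.

Definition has_form (n : nat) (sigma : 'I_n -> 'I_n -> 'I_n -> sign)
    (a b c d : 'I_n) (x1 x2 x3 x4 : sign) : Prop :=
  [/\ sigma a b c = x1, sigma a b d = x2, sigma a c d = x3 & sigma b c d = x4].

(* Main.v *)
Require Import Defs.
From HB Require Import structures.
From mathcomp Require Import all_boot all_order all_algebra.
From mathcomp Require Import all_classical all_reals all_analysis.
From mathcomp Require Import zify ring lra.

(* A sign function with at most one sign change on every 4-tuple orders the
   pairs of indices like the slopes of the lines through n points: this order
   is built by induction, inserting the lines through the last point between
   those below and those above it.  Reading off on which side of each line
   every vertex lies, two lines can be told to cross right after the last vertex
   that forces the one of smaller slope to be on top; this orders all lines
   consistently at each vertex and inverts every pair exactly once.
   Interpolating linearly between the vertices gives the pseudolines, and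
   generic heights exclude triple points.

   Conversely, in a pseudolinear drawing two edges meet at most once.  If the
   signs of abc, abd, acd or of abd, acd, bcd alternated, the edges ac and ad, or
   bd and ad, would meet once more besides their common end.  If abc and bcd had
   the same sign and abd the opposite one, the edges ac and bd would cross, and
   the pseudoline of bd, followed from d through b, would be trapped in the
   bounded region enclosed by ac, bd and ad. *)

Set Implicit Arguments.
Unset Strict Implicit.
Unset Printing Implicit Defensive.

Import Order.TTheory GRing.Theory Num.Theory.
Import numFieldNormedType.Exports.

(** * Slope orders *)

(* The order by rank, with the pairs in [inv] reversed. *)
Definition twist (T : Type) (r : T -> nat) (inv : rel T) : rel T := fun x y =>
  if r x < r y then ~~ inv x y else (r y < r x) && inv y x.

(** On rank-increasing triples the reversed and the unreversed pairs are both transitive, as in the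
    inversion set of a permutation. Each relative position of x, y, z uses one of the two
    conditions. *)
Lemma twist_trans (T : eqType) (D : pred T) (r : T -> nat) (inv : rel T) :
  {in D &, injective r} ->
  (forall x y z, D x -> D y -> D z -> r x < r y -> r y < r z ->
     [/\ inv x y -> inv y z -> inv x z & inv x z -> inv x y || inv y z]) ->
  forall x y z, D x -> D y -> D z ->
    twist r inv x y -> twist r inv y z -> twist r inv x z.
Proof.
move=> r_inj Hinv x y z Dx Dy Dz; rewrite /twist.
case: (ltngtP (r x) (r y)) => Hxy //=; case: (ltngtP (r y) (r z)) => Hyz //=;
  case: (ltngtP (r x) (r z)) => Hxz //=; try lia.
- by have [_ H] := Hinv _ _ _ Dx Dy Dz Hxy Hyz; move=> *; apply/negP=> /H; lia.
- have [H _] := Hinv _ _ _ Dx Dz Dy Hxz Hyz.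
  by move=> /negP Nxy zy; apply/negP=> xz; apply/Nxy/H.
- by have [_ H] := Hinv _ _ _ Dz Dx Dy Hxz Hxy; move=> /negbTE Nxy /H; rewrite Nxy orbF.
- by rewrite (r_inj _ _ Dx Dz Hxz) => /negP.
- have [H _] := Hinv _ _ _ Dy Dx Dz Hxy Hxz.
  by move=> yx /negP Nyz; apply/negP=> xz; apply/Nyz/H.
- by have [_ H] := Hinv _ _ _ Dy Dz Dx Hyz Hxz; move=> /H + /negbTE Nyz; rewrite Nyz.
- by rewrite (r_inj _ _ Dx Dz Hxz) => ->.
- have [H _] := Hinv _ _ _ Dz Dy Dx Hyz Hxy.
  by move=> yx zy; apply: H.
Qed.

Lemma twist_irr (T : Type) (r : T -> nat) (inv : rel T) : irreflexive (twist r inv).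
Proof. by move=> x; rewrite /twist ltnn. Qed.

(** Counting predecessors turns a strict order into integer ranks: transitivity gives the inclusion
    of predecessor sets, and x itself makes it strict. *)
Lemma card_strict_order (T : finType) (D : pred T) (R : rel T) :
  irreflexive R ->
  (forall x y z, D x -> D y -> D z -> R x y -> R y z -> R x z) ->
  forall x y, D x -> D y -> R x y ->
    #|[pred c | D c && R c x]| < #|[pred c | D c && R c y]|.
Proof.
move=> Rirr Rtr x y Dx Dy xy; apply: proper_card; apply/properP; split.
  apply/fintype.subsetP=> c; rewrite !inE => /andP[Dc cx].
  by rewrite Dc (Rtr _ x).
by exists x; rewrite !inE ?Dx ?xy ?Rirr.
Qed.

(* The eight admissible forms are those with at most one sign change. *)
Definition monotone4 (x1 x2 x3 x4 : bool) : bool :=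
  (x1 != x2) + (x2 != x3) + (x3 != x4) <= 1.

Definition signotope (n : nat) (s : nat -> nat -> nat -> bool) : Prop :=
  forall a b c d, a < b -> b < c -> c < d -> d < n ->
    monotone4 (s a b c) (s a b d) (s a c d) (s b c d).

(* [r] ranks the lines [v_i v_j] by slope: the slopes of a counterclockwise
   triple a < b < c increase in the order ab, ac, bc. *)
Definition slope_rank (n : nat) (s : nat -> nat -> nat -> bool)
    (r : nat * nat -> nat) : Prop :=
  (forall e f, e.1 < e.2 < n -> f.1 < f.2 < n -> r e = r f -> e = f) /\
  (forall a b c, a < b -> b < c -> c < n ->
     if s a b c then r (a, b) < r (a, c) < r (b, c)
     else r (b, c) < r (a, c) < r (a, b)).

(** The signs of abc, abn, acn, bcn change at most once, so the lines among ab, ac, bc that pass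
    above the last point n form a top segment of their old order, and raising them keeps that
    order. *)
Lemma slope_rank_exists n s : signotope n s -> exists r, slope_rank n s r.
Proof.
elim: n => [|n IHn] Hs.
  by exists (fun _ => 0); split=> [e f|a b c]; rewrite ltn0 ?andbF.
have [|r [r_inj r_tri]] := IHn; first by move=> a b c d *; apply: Hs; lia.
(* For a < b, [before a b] amounts to [s a b n]: the line an has smaller slope than bn. *)
pose before := twist id (fun a b => ~~ s a b n).
pose cnt a := #|[pred c : 'I_n | true && before c a]|.
have before_tr a b c : a < n -> b < n -> c < n ->
    before a b -> before b c -> before a c.
  apply: (@twist_trans _ (fun a => a < n)) => //.
  move=> {}a {}b {}c an bn cn ab bc.
  have := Hs a b c n ab bc cn (ltnSn n); rewrite /monotone4 /=.
  by case: (s a b n); case: (s a c n); case: (s b c n); case: (s a b c).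
have cnt_lt a b : a < n -> b < n -> before a b -> cnt a < cnt b.
  move=> an bn ab.
  apply: (@card_strict_order 'I_n predT (fun x y : 'I_n => before x y) _ _
    (Ordinal an) (Ordinal bn)) => //; first by move=> x; apply: twist_irr.
  by move=> x y z _ _ _; apply: before_tr.
have cnt_le a : cnt a <= n by rewrite -[leqRHS]card_ord max_card.
pose M := (\max_(e : 'I_n * 'I_n) r (val e.1, val e.2)).+1.
have rM a b : a < n -> b < n -> r (a, b) < M.
  move=> an bn; rewrite ltnS.
  exact: (leq_bigmax (F := fun e : 'I_n * 'I_n => r (val e.1, val e.2))
    (Ordinal an, Ordinal bn)).
(* The lines through [v_n], in the order given by [s _ _ n], are inserted
   between the lines passing below [v_n] and those passing above it. *)
pose r' (e : nat * nat) :=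
  if e.2 == n then M + cnt e.1
  else if s e.1 e.2 n then r e else M + n.+1 + r e.
have r'E1 a b : b < n ->
    r' (a, b) = if s a b n then r (a, b) else M + n.+1 + r (a, b).
  by move=> bn; rewrite /r' /= ifF //; lia.
have r'E3 a : r' (a, n) = M + cnt a by rewrite /r' /= eqxx.
exists r'; split.
  move=> [a b] [c d] /= /andP[ab bn] /andP[cd dn].
  have [{}bn|{}bn] : b < n \/ b = n by lia.
    have [{}dn|{}dn] : d < n \/ d = n by lia.
    + have Hr : r (a, b) < M /\ r (c, d) < M by split; apply: rM; lia.
      have I : r (a, b) = r (c, d) -> (a, b) = (c, d) by apply: r_inj => /=; lia.
      rewrite !r'E1 // => Hrr; apply: I; move: Hrr.
      by case: (s a b n); case: (s c d n); lia.
    + have Hr := rM a b ltac:(lia) bn; have Hc := cnt_le c; subst d.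
      by rewrite r'E3 r'E1 //; case: (s a b n); lia.
  have [{}dn|{}dn] : d < n \/ d = n by lia.
    have Hr := rM c d ltac:(lia) dn; have Hc := cnt_le a; subst b.
    by rewrite r'E3 r'E1 //; case: (s c d n); lia.
  subst b d; rewrite !r'E3 => Hc.
  have [->//|ne] := eqVneq a c.
  have : before a c || before c a.
    by rewrite /before /twist; case: ltngtP ne => //= ?; rewrite ?negbK;
      case: (s _ _ _).
  by case/orP=> /cnt_lt; lia.
move=> a b c ab bc; rewrite ltnS leq_eqVlt => /orP[/eqP cn|cn].
  subst c; have Hr := rM a b ltac:(lia) bc.
  have [Ha Hb] := (cnt_le a, cnt_le b); have an : a < n by lia.
  rewrite !r'E3 r'E1 //; case: ifP => sab.
    have : before a b by rewrite /before /twist ab sab.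
    by move=> /(cnt_lt _ _ an bc); lia.
  have : before b a.
    by rewrite /before /twist ab sab ltnNge (ltnW ab).
  by move=> /(cnt_lt _ _ bc an); rewrite sab; lia.
have := r_tri _ _ _ ab bc cn; have := Hs a b c n ab bc cn (ltnSn n).
have := (rM a b ltac:(lia) ltac:(lia), rM a c ltac:(lia) ltac:(lia),
         rM b c ltac:(lia) ltac:(lia)) => -[[Mab Mac] Mbc].
rewrite /monotone4 !r'E1 //; try lia.
by case: (s a b c); case: (s a b n); case: (s a c n); case: (s b c n) => //=; lia.
Qed.

(** * Sides of lines and the order of crossings *)

Definition on_line (e : nat * nat) (j : nat) : bool := (j == e.1) || (j == e.2).

(** A positive triple turns counterclockwise: each outer vertex lies above the line through the
    other two and the middle one lies below, whence the negation in the last case. *)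
Definition above_line (s : nat -> nat -> nat -> bool) (e : nat * nat) (j : nat) : bool :=
  if j < e.1 then s j e.1 e.2
  else if e.2 < j then s e.1 e.2 j
  else [&& e.1 < j, j < e.2 & ~~ s e.1 j e.2].

(* At vertex [j] the line [e] runs above [f], or both pass through the vertex.
   If [e] has the smaller slope, [j] is then not to the right of the crossing. *)
Definition left_of (s : nat -> nat -> nat -> bool) (e f : nat * nat) (j : nat) : bool :=
  ~~ above_line s e j && (on_line f j || above_line s f j).

Section Slopes.
Variables (n : nat) (s : nat -> nat -> nat -> bool) (r : nat * nat -> nat).
Hypothesis r_slope : slope_rank n s r.

(* The vertices ordered by their projection along a direction of slope just
   below that of [e]. *)
Let before (e : nat * nat) : rel nat := twist id (fun j k => r (j, k) < r e).

Let before_trans e i j k : i < n -> j < n -> k < n ->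
  before e i j -> before e j k -> before e i k.
Proof.
have [_ r_tri] := r_slope.
apply: (@twist_trans _ (fun a => a < n)) => // {}i {}j {}k _ _ kn ij jk.
by have := r_tri _ _ _ ij jk kn; case: ifP; lia.
Qed.

Let above_before e j : e.1 < e.2 < n -> j < n -> ~~ on_line e j ->
  if above_line s e j then before e e.1 j && before e e.2 j
  else before e j e.1 && before e j e.2.
Proof.
case: e => a b /=; have [_ r_tri] := r_slope; rewrite /on_line /above_line /=.
rewrite negb_or => /andP[ab bn] jn /andP[ja jb].
rewrite /before /twist /=.
case: (ltngtP j a) ja => // ja _.
  by have := r_tri _ _ _ ja ab bn; case: (s j a b); case: (ltngtP j b); lia.
case: (ltngtP j b) jb => // jb _.
  by have := r_tri _ _ _ ja jb bn; case: (s a j b) => /=; lia.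
by have := r_tri _ _ _ ab jb jn; case: (s a b j) => /=; lia.
Qed.

Let before_of_height e j k : e.1 < e.2 < n -> j < n -> k < n ->
  ~~ above_line s e j -> on_line e k || above_line s e k ->
  ~~ (on_line e j && on_line e k) -> before e j k.
Proof.
move=> en jn kn aj ak /negP jk.
have := above_before en jn; have := above_before en kn; rewrite (negbTE aj).
move: jk ak; case: (boolP (on_line e j)) => oj; case: (boolP (on_line e k)) => //= ok _.
- by move=> -> /(_ isT) /andP[B1 B2] _; case/orP: oj => /eqP->.
- by move=> _ _ /(_ isT) /andP[B1 B2]; case/orP: ok => /eqP->.
- move=> -> /(_ isT) /andP[B1 _] /(_ isT) /andP[B2 _]; apply: before_trans B1 => //; lia.
Qed.

(** Projected along e the vertex j comes before k, and along f it comes after. If k < j, the rank of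
    the line kj would be less than [r e] and at least [r f]. *)
Lemma left_of_lt e f j k : e.1 < e.2 < n -> f.1 < f.2 < n -> j < n -> k < n ->
  r e < r f -> j != k -> left_of s e f j -> left_of s f e k -> j < k.
Proof.
move=> en fn jn kn ef jk /andP[ej fj] /andP[fk ek].
have He := before_of_height en jn kn ej ek.
have Hf := before_of_height fn kn jn fk fj.
have pair g : g.1 < g.2 -> on_line g j && on_line g k -> g = if j < k then (j, k) else (k, j).
  case: g => a b /= ab /andP[/orP[]/eqP /= jE /orP[]/eqP /= kE]; subst j k.
  - by rewrite eqxx in jk.
  - by rewrite ab.
  - by rewrite ltnNge (ltnW ab).
  - by rewrite eqxx in jk.
(* If both vertices lie on e, their heights over e do not order them, but then e is itself the line
   through them. *)
case: (boolP (on_line e j && on_line e k)) => Ce.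
  have {}Ce := pair _ (proj1 (andP en)) Ce.
  case: (ltngtP j k) jk Ce => // kj _ Ce.
  have /Hf : ~~ (on_line f k && on_line f j).
    rewrite andbC; apply/negP => /(pair _ (proj1 (andP fn))) Cf.
    by move: ef; rewrite Ce Cf ifF ?ltnn //; lia.
  by rewrite /before /twist kj -Ce ef.
have {He} := He Ce.
case: (boolP (on_line f k && on_line f j)) => Cf.
  rewrite andbC in Cf; have {}Cf := pair _ (proj1 (andP fn)) Cf.
  case: (ltngtP j k) jk Cf => // kj _ Cf.
  by rewrite /before /twist ltnNge (ltnW kj) /= kj -Cf; lia.
have := Hf Cf.
by rewrite /before /twist; case: ltngtP jk => // kj _ /=; lia.
Qed.

End Slopes.

(** * Levels of the lines at the vertices *)

Lemma above_line_on s e j : e.1 < e.2 -> on_line e j -> above_line s e j = false.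
Proof.
by rewrite /on_line /above_line => ? /orP[]/eqP->; rewrite !ltnn ?andbF //= ltnNge ltnW.
Qed.

Section Heights.
Variables (n : nat) (s : nat -> nat -> nat -> bool) (r : nat * nat -> nat).
Hypothesis r_slope : slope_rank n s r.

(* Lines cross as late as the vertices allow: [e] is above [f], of larger slope,
   as long as a vertex at abscissa k or further right forces it.  The abscissa
   k.+1 is that of vertex k; 0 and n.+1 lie left and right of all vertices. *)
Definition inverted (k : nat) : rel (nat * nat) := fun e f =>
  (k == 0) || [exists j : 'I_n, (k <= j.+1) && left_of s e f j].

Definition tied (k : nat) (e f : nat * nat) : bool :=
  [&& 0 < k, on_line e k.-1 & on_line f k.-1].

Definition lower (k : nat) : rel (nat * nat) := fun e f =>
  ~~ tied k e f && twist r (inverted k) e f.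

Let edge (e : nat * nat) := e.1 < e.2 < n.

Let invertedP k e f : 0 < k ->
  reflect (exists j, [/\ j < n, k <= j.+1 & left_of s e f j]) (inverted k e f).
Proof.
move=> k0; rewrite /inverted eqn0Ngt k0 /=; apply: (iffP existsP).
  by move=> [j /andP[kj ?]]; exists (val j); split=> //; apply: ltn_ord.
by move=> [j [jn kj H]]; exists (Ordinal jn); apply/andP.
Qed.

Let left_of_anti e f j k : edge e -> edge f -> j < n -> k < n ->
  r e < r f -> left_of s e f j -> left_of s f e k -> j <= k.
Proof.
move=> en fn jn kn ef jef kfe; have [->//|jk] := eqVneq j k.
exact/ltnW/(left_of_lt r_slope _ _ _ _ ef jk).
Qed.

(** The side of f at a witness for e, g splits that inversion into one of e, f or of f, g.
    Conversely, if the witnesses j for e, f and i for f, g both fail for e, g, then g is over f at j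
    and f over e at i, so the order of crossings forces i = j. *)
Let below_trans k e f g : edge e -> edge f -> edge g ->
  twist r (inverted k) e f -> twist r (inverted k) f g -> twist r (inverted k) e g.
Proof.
apply: (twist_trans (D := edge)) => {e f g} [e f en fn|e f g en fn gn ef fg].
  by apply: (proj1 r_slope).
have [->|k0] := posnP k; first by [].
split=> [/(invertedP _ _ k0)[j [jn kj jef]] /(invertedP _ _ k0)[i [i_n ki ifg]]|].
  case: (boolP (left_of s e g j)) => [?|Nj]; first by apply/invertedP => //; exists j.
  case: (boolP (left_of s e g i)) => [?|Ni]; first by apply/invertedP => //; exists i.
  have gfj : left_of s g f j.
    by move: jef Nj; rewrite /left_of => /andP[-> ->]; rewrite negb_or andbT => /andP[].
  have fei : left_of s f e i.
    by move: ifg Ni; rewrite /left_of => /andP[-> ->]; rewrite andbT negbK => ->; rewrite orbT.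
  have ij : i = j.
    apply/eqP; rewrite eqn_leq (left_of_anti en fn jn i_n ef jef fei).
    by rewrite (left_of_anti fn gn i_n jn fg ifg gfj).
  subst i; case/negP: Nj; move: jef ifg; rewrite /left_of => /andP[-> _] /andP[_ ->].
  by [].
move=> /(invertedP _ _ k0)[j [jn kj]].
rewrite {1}/left_of => /andP[ej gj]; apply/orP.
case: (boolP (above_line s f j)) => fj; [left|right]; apply/invertedP => //;
  by exists j; split=> //; rewrite /left_of ?ej ?fj ?gj ?orbT.
Qed.

(** If [r e < r f], the vertex i would witness an inversion. Otherwise a witness j of the inversion
    has i <= j, and [left_of s e f i] would give j <= i; at j = i both lines pass through the vertex
    and are tied. *)
Let lower_height i e f : edge e -> edge f -> i < n ->
  lower i.+1 e f -> ~~ left_of s e f i.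
Proof.
move=> en fn i_n /andP[]; rewrite /tied /= => Nt.
rewrite /twist; case: ltngtP => //= ef.
  by move=> /invertedP N; apply/negP => H; apply: N => //; exists i.
move=> /(invertedP _ _ (ltn0Sn i))[j [jn ij jfe]]; apply/negP => ief.
have ji := left_of_anti fn en jn i_n ef jfe ief.
have {ij ji} ij : j = i by lia.
subst j; move: jfe ief Nt; rewrite /left_of.
by case: (above_line s e i); case: (above_line s f i); rewrite //= !orbF => -> ->.
Qed.

(** Only a tie of e and g needs an argument: f would pass above their common vertex, being above e,
    and below it, being below g. *)
Let lower_trans k e f g : k <= n.+1 -> edge e -> edge f -> edge g ->
  lower k e f -> lower k f g -> lower k e g.
Proof.
move=> kn en fn gn ef fg; rewrite /lower (below_trans en fn gn) ?andbT; first last.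
- by case/andP: fg.
- by case/andP: ef.
apply/negP; case: k kn ef fg => [|i] // _ ef fg /andP[_ /= /andP[ie ig]].
have i_n : i < n by move: ie; rewrite /on_line; move: en; rewrite /edge; lia.
have := lower_height en fn i_n ef; have := lower_height fn gn i_n fg.
have e12 := proj1 (andP en); have g12 := proj1 (andP gn).
rewrite /left_of (above_line_on _ e12 ie) (above_line_on _ g12 ig) ig /=.
by rewrite andbT negbK => ->; rewrite orbT.
Qed.

Let lower_total k e f : edge e -> edge f -> e != f -> ~~ tied k e f ->
  lower k e f || lower k f e.
Proof.
move=> en fn ef; rewrite /lower /tied [on_line f _ && _]andbC => ->.
rewrite /= /twist; case: ltngtP => //= [_|_|rr].
- by case: inverted.
- by case: inverted.
- by case/eqP: ef; apply: (proj1 r_slope).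
Qed.

Definition npair (c : 'I_n * 'I_n) : nat * nat := (c.1 : nat, c.2 : nat).

Definition level (k : nat) (e : nat * nat) : nat :=
  #|[pred c : 'I_n * 'I_n | (c.1 < c.2) && lower k (npair c) e]|.

Definition vertex_level (i : nat) : nat :=
  #|[pred c : 'I_n * 'I_n | (c.1 < c.2) && above_line s (npair c) i]|.

Let npair_edge (c : 'I_n * 'I_n) : c.1 < c.2 -> edge (npair c).
Proof. by move=> ?; rewrite /edge /=; apply/andP. Qed.

Let level_lt k e f : k <= n.+1 -> edge e -> edge f -> lower k e f ->
  level k e < level k f.
Proof.
move=> kn; case: e => a b; case: f => c d en fn.
have an : a < n by move: en; rewrite /edge /=; lia.
have bn : b < n by move: en; rewrite /edge /=; lia.
have cn : c < n by move: fn; rewrite /edge /=; lia.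
have dn : d < n by move: fn; rewrite /edge /=; lia.
apply: (@card_strict_order ('I_n * 'I_n)%type (fun c => c.1 < c.2)
  (fun c d => lower k (npair c) (npair d)) _ _ (Ordinal an, Ordinal bn)
  (Ordinal cn, Ordinal dn)) => [x|x y z xe ye ze||] //=.
- by rewrite /lower twist_irr andbF.
- by apply: lower_trans => //; apply: npair_edge.
- by case/andP: en.
- by case/andP: fn.
Qed.

Let lower_on i c e : edge c -> edge e -> i < n -> on_line e i ->
  lower i.+1 c e = above_line s c i.
Proof.
move=> cn en i_n ei; have Ne := above_line_on s (proj1 (andP en)) ei.
case: (boolP (above_line s c i)) => ci; last first.
  apply/negP => /(lower_height cn en i_n).
  by rewrite /left_of ci ei.
have Nt : ~~ tied i.+1 c e.
  rewrite /tied /= ei andbT; apply/negP => /(above_line_on s (proj1 (andP cn))).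
  by rewrite ci.
have ce : c != e by apply: contraNneq Nt => ce; move: ci; rewrite ce Ne.
have /orP[//|] := lower_total cn en ce Nt.
by move=> /(lower_height en cn i_n); rewrite /left_of Ne ci orbT.
Qed.

Lemma level_on i e : edge e -> i < n -> on_line e i -> level i.+1 e = vertex_level i.
Proof.
move=> en i_n ei; apply: eq_card => c; rewrite !inE.
by case: ltnP => //= c12; rewrite lower_on //; apply: npair_edge.
Qed.

Lemma level_off i e : edge e -> i < n -> ~~ on_line e i ->
  if above_line s e i then level i.+1 e < vertex_level i
  else vertex_level i < level i.+1 e.
Proof.
move=> en i_n ei.
(* Every line f through the vertex has the level of the vertex, so it suffices to compare e with
   f. *)
have [f fn fi] : exists2 f, edge f & on_line f i.
  case: (ltngtP i e.1) => H; [exists (i, e.1)|exists (e.1, i)|exists e] => //;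
    move: en; rewrite /edge /on_line ?H /= ?eqxx ?orbT //; lia.
rewrite -(level_on fn i_n fi).
have Nt : ~~ tied i.+1 e f by rewrite /tied /= (negbTE ei).
have ef : e != f by apply: contraNneq ei => ->.
case: ifP => ai.
  by apply: (level_lt (leqW i_n) en fn); rewrite (lower_on en fn).
apply: (level_lt (leqW i_n) fn en).
by have := lower_total en fn ef Nt; rewrite (lower_on en fn) // ai.
Qed.

Lemma level_neq k e f : k <= n.+1 -> edge e -> edge f -> e != f ->
  ~~ tied k e f -> level k e != level k f.
Proof.
by move=> kn en fn ef /(lower_total en fn ef)/orP[] /level_lt; lia.
Qed.

(** Inversion holds on an initial range of abscissas that contains 0 but not n.+1, and a common
    vertex can only sit at the end of that range. The weak inequality at m covers a crossing at a
    common vertex. *)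
Lemma level_cross e f : edge e -> edge f -> r e < r f ->
  exists m, [/\ 0 < m <= n.+1,
    forall k, k < m -> level k f < level k e,
    level m e <= level m f,
    forall k, m < k <= n.+1 -> level k e < level k f &
    level n.+1 e < level n.+1 f].
Proof.
move=> en fn ef.
have Nef : e != f by apply: contraTneq ef => ->; rewrite ltnn.
have inv0 : exists k, inverted k e f by exists 0.
have inv_le k : inverted k e f -> k <= n.
  by case: k => // k /(invertedP _ _ (ltn0Sn k))[j [jn]]; lia.
have inv_down k k' : k <= k' -> inverted k' e f -> inverted k e f.
  case: (posnP k) => [->//|k0 kk'].
  move=> /(invertedP _ _ (leq_trans k0 kk'))[j [jn H1 H2]].
  by apply/invertedP => //; exists j; split=> //; lia.
have tied_left k : tied k e f -> [/\ 0 < k, k.-1 < n, left_of s e f k.-1 & left_of s f e k.-1].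
  move=> /and3P[k0 ke kf]; split=> //.
  - by move: ke en; rewrite /on_line /edge; lia.
  - by rewrite /left_of kf (above_line_on _ (proj1 (andP en)) ke).
  - by rewrite /left_of ke (above_line_on _ (proj1 (andP fn)) kf).
have tied_inv k : tied k e f -> inverted k e f.
  by move=> /tied_left[k0 kn H _]; apply/invertedP => //; exists k.-1; split=> //; lia.
have inv_tied k k' : k < k' -> inverted k' e f -> ~~ tied k e f.
  move=> kk' /invertedP-/(_ ltac:(lia))[j [jn kj jef]].
  apply/negP => /tied_left[k0 kn _ kfe].
  have := left_of_anti en fn jn kn ef jef kfe; lia.
have inv_lower k : inverted k e f -> ~~ tied k e f -> level k f < level k e.
  move=> ik tk; apply: level_lt => //; first exact/leqW/inv_le.
  rewrite /lower /twist ltnNge (ltnW ef) /= ef ik andbT.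
  by move: tk; rewrite /tied [on_line f _ && _]andbC andbT.
have ninv_lower k : k <= n.+1 -> ~~ inverted k e f -> level k e < level k f.
  move=> kn ik; apply: level_lt => //.
  by rewrite /lower /twist ef ik andbT; apply: contra ik; apply: tied_inv.
have last_lt : level n.+1 e < level n.+1 f.
  by apply: ninv_lower => //; apply/negP => /inv_le; rewrite ltnn.
case: (ex_maxnP inv0 inv_le) => m0 im0 m0_max.
(* At a common vertex the levels agree at m0 itself; otherwise the lines switch between m0 and
   m0.+1. *)
have [tm0|tm0] := boolP (tied m0 e f).
  have [m00 m0n _ _] := tied_left _ tm0.
  exists m0; split.
  - by lia.
  - by move=> k km; apply: inv_lower (inv_tied _ _ km im0); apply: inv_down im0; lia.
  - rewrite -(prednK m00) leq_eqVlt !level_on ?eqxx //; first by case/and3P: tm0.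
    by case/and3P: tm0.
  - by move=> k /andP[mk kn]; apply: ninv_lower => //; apply/negP => /m0_max; lia.
  - exact: last_lt.
exists m0.+1; split.
- have := inv_le _ im0; lia.
- move=> k km; apply: inv_lower; first by apply: inv_down im0; lia.
  have [->//|ne] := eqVneq k m0; apply: inv_tied im0; lia.
- apply/ltnW/ninv_lower; first by have := inv_le _ im0; lia.
  by apply/negP => /m0_max; lia.
- by move=> k /andP[mk kn]; apply: ninv_lower => //; apply/negP => /m0_max; lia.
- exact: last_lt.
Qed.

End Heights.

Local Open Scope classical_set_scope.
Local Open Scope ring_scope.

(** * Piecewise linear curves *)

Section Clamp.
Variable R : realType.

Definition clamp (a b u : R) : R := Num.max a (Num.min b u).

Lemma clamp_left a b u : u <= a -> clamp a b u = a.
Proof. by move=> ua; apply/max_idPl; rewrite ge_min ua orbT. Qed.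

Lemma clamp_right a b u : a <= b -> b <= u -> clamp a b u = b.
Proof. by move=> ab bu; rewrite /clamp (min_idPl bu); apply/max_idPr. Qed.

Lemma clamp_itv a b u : a <= b -> clamp a b u \in `[a, b].
Proof. by move=> ab; rewrite in_itv /= /clamp le_max lexx /= ge_max ab ge_min lexx. Qed.

Lemma clamp_id a b u : u \in `[a, b] -> clamp a b u = u.
Proof.
by rewrite in_itv /= => /andP[u0 u1]; rewrite /clamp (min_idPr u1); apply/max_idPr.
Qed.

Lemma clamp_continuous a b : continuous (clamp a b).
Proof.
move=> u; apply: (@continuous_max R R (fun=> a) (fun v => Num.min b v)).
  exact: cst_continuous.
by apply: (@continuous_min R R (fun=> b) id); [exact: cst_continuous|].
Qed.

Lemma continuous_clamped (U : topologicalType) a b (f : R -> U) : a <= b ->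
  {within `[a, b], continuous f} -> continuous (f \o clamp a b).
Proof.
move=> ab /subspace_continuousP cf x.
have inA u : `[a, b]%classic (clamp a b u) by exact: clamp_itv.
apply: (cvg_comp _ _ _ (cf _ (inA x))) => B wB.
have : \forall u \near x, `[a, b]%classic (clamp a b u) -> B (clamp a b u).
  exact: (@clamp_continuous a b x _ wB).
by apply: filterS => u; apply.
Qed.

End Clamp.

Section Interpolation.
Variable R : realType.
Implicit Types (h : nat -> R) (x : R).

(** Each summand varies only between k and k.+1, so continuity and additivity in [h] follow term by
    term, and the function is constant left of 0 and right of N. *)
Definition interp (N : nat) h x : R :=
  h 0%N + \sum_(k < N) (h k.+1 - h k) * clamp 0 1 (x - k%:R).

Lemma interpS N h x :
  interp N.+1 h x = interp N h x + (h N.+1 - h N) * clamp 0 1 (x - N%:R).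
Proof. by rewrite /interp big_ord_recr addrA. Qed.

Lemma interp_continuous N h : continuous (interp N h).
Proof.
elim: N => [|N IHN] x.
  by apply: (cvg_near_cst (interp 0 h x)); near=> y; rewrite /interp !big_ord0.
rewrite (_ : interp N.+1 h = fun x => interp N h x +
  (h N.+1 - h N) * clamp 0 1 (x - N%:R)); last by apply/funext => y; apply: interpS.
apply: cvgD; first exact: IHN.
apply: cvgM; first exact: cvg_cst.
apply: (@continuous_comp _ _ _ (fun y : R => y - N%:R) (clamp 0 1)).
  by apply: cvgB; [exact: cvg_id|exact: cvg_cst].
exact: clamp_continuous.
Unshelve. all: by end_near.
Qed.

Lemma interpB N h h' x :
  interp N h x - interp N h' x = interp N (fun k => h k - h' k) x.
Proof.
rewrite /interp opprD addrACA; congr (_ + _); rewrite -sumrB.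
by apply: eq_bigr => k _; ring.
Qed.

Lemma interp_left N h x : x <= 0 -> interp N h x = h 0%N.
Proof.
move=> x0; rewrite /interp big1 ?addr0 // => k _.
by rewrite clamp_left ?mulr0 // subr_le0 (le_trans x0).
Qed.

Lemma interp_right N h x : N%:R <= x -> interp N h x = h N.
Proof.
elim: N => [|N IHN] Nx; first by rewrite /interp big_ord0 addr0.
rewrite interpS IHN; last by apply: le_trans Nx; rewrite ler_nat.
by rewrite (clamp_right ler01); [ring|rewrite lerBrDr addrC natr1].
Qed.

Lemma interp_segment N h k x : (k < N)%N -> k%:R <= x <= k.+1%:R ->
  interp N h x = h k + (h k.+1 - h k) * (x - k%:R).
Proof.
elim: N => // N IHN; rewrite ltnS => kN kx; rewrite interpS.
move: kN; rewrite leq_eqVlt => /orP[/eqP kN|kN].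
  subst k; case/andP: kx => x1 x2; rewrite interp_right // clamp_id //.
  by rewrite in_itv /= subr_ge0 x1 lerBlDr addrC natr1.
rewrite IHN // clamp_left ?mulr0 ?addr0 //.
by rewrite subr_le0 (le_trans (proj2 (andP kx))) // ler_nat.
Qed.

Lemma interp_node N h k : (k <= N)%N -> interp N h k%:R = h k.
Proof.
rewrite leq_eqVlt => /orP[/eqP->|kN]; first by rewrite interp_right.
by rewrite (interp_segment _ kN) ?lexx ?ler_nat ?leqnSn // subrr mulr0 addr0.
Qed.

Lemma nat_segment N x : 0 <= x <= N%:R ->
  (exists2 k, (k < N)%N & k%:R <= x <= k.+1%:R) \/ x = 0.
Proof.
move=> /andP[x0]; elim: N => [|N IHN] xN; first by right; apply/le_anti/andP.
have [/IHN[[k kN kx]|->]|Nx] := leP x N%:R; last 1 first.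
- by left; exists N => //; rewrite (ltW Nx).
- by left; exists k => //; apply: ltnW.
- by right.
Qed.

Lemma interp_cross N h m : (0 < m <= N)%N ->
  (forall k, (k < m)%N -> 0 < h k) -> h m <= 0 ->
  (forall k, (m < k <= N)%N -> h k < 0) -> h N < 0 ->
  exists z, [/\ interp N h z = 0, forall x, x < z -> 0 < interp N h x &
    forall x, z < x -> interp N h x < 0].
Proof.
case: m => // m /andP[_ mN] hpos hm hneg hN.
have h0 := hpos m (ltnSn m).
have d0 : 0 < h m - h m.+1 by lra.
(* [m] now denotes the predecessor of the original index. The linear piece from [h m > 0] to
   [h m.+1 <= 0] vanishes at t. *)
pose t := h m / (h m - h m.+1).
have t0 : 0 < t by apply: divr_gt0.
have t1 : t <= 1 by rewrite /t ler_pdivrMr // mul1r; lra.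
have tE : t * (h m - h m.+1) = h m by rewrite /t divfK // gt_eqF.
have mS : m.+1%:R = m%:R + 1 :> R by rewrite -natr1.
exists (m%:R + t).
have zm : interp N h (m%:R + t) = 0.
  rewrite (interp_segment _ mN); last by rewrite mS; lra.
  by move: tE; lra.
split=> // x xz.
  have [x0|x0] := lerP x 0; first by rewrite interp_left // hpos.
  have xN : x <= N%:R.
    by apply: (le_trans (ltW xz)); apply: (@le_trans _ _ m.+1%:R); [lra|rewrite ler_nat].
  have [[k kN kx]|xE] := @nat_segment N x ltac:(lra); last by lra.
  rewrite (interp_segment _ kN kx).
  have kS : k.+1%:R = k%:R + 1 :> R by rewrite -natr1.
  have km : (k <= m)%N.
    rewrite -ltnS -(ltr_nat R); case/andP: kx; lra.
  move: km; rewrite leq_eqVlt => /orP[/eqP km|km].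
    subst k; set u := x - m%:R.
    have ut : u < t by rewrite /u; lra.
    have : u * (h m - h m.+1) < t * (h m - h m.+1) by rewrite ltr_pM2r.
    by rewrite tE; lra.
  have hk := hpos k (ltnW km); have hk1 := hpos k.+1 km.
  case/andP: kx; rewrite kS => kx1 kx2.
  have [->|xk] := eqVneq x k%:R; first by rewrite subrr mulr0 addr0.
  have u0 : 0 < x - k%:R by rewrite subr_gt0 lt_neqAle eq_sym xk.
  have : 0 < h k.+1 * (x - k%:R) by apply: mulr_gt0.
  have : 0 <= h k * (1 - (x - k%:R)) by apply: mulr_ge0; lra.
  lra.
have [Nx|xN] := lerP N%:R x; first by rewrite interp_right.
have x0 : 0 < x by apply: lt_trans xz; apply: ltr_wpDl.
have [[k kN kx]|xE] := @nat_segment N x ltac:(lra); last by lra.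
rewrite (interp_segment _ kN kx).
have kS : k.+1%:R = k%:R + 1 :> R by rewrite -natr1.
have mk : (m <= k)%N.
  rewrite -ltnS -(ltr_nat R); case/andP: kx; lra.
move: mk; rewrite leq_eqVlt => /orP[/eqP km|km].
  subst k; set u := x - m%:R.
  have ut : t < u by rewrite /u; lra.
  have : t * (h m - h m.+1) < u * (h m - h m.+1) by rewrite ltr_pM2r.
  by rewrite tE; lra.
have hk : h k <= 0.
  by move: km; rewrite leq_eqVlt => /orP[/eqP<-//|km]; apply/ltW/hneg; rewrite km ltnW.
have hk1 : h k.+1 < 0 by apply: hneg; rewrite ltnS km.
case/andP: kx; rewrite kS => kx1 kx2.
(* At the node k = m.+1 only [h k <= 0] is given; it is strict because z < x means t < 1. *)
have [xk|xk] := eqVneq x k%:R.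
  rewrite xk subrr mulr0 addr0.
  move: km; rewrite leq_eqVlt => /orP[/eqP km|km]; last by rewrite hneg // km ltnW.
  have : t * (h m - h m.+1) < 1 * (h m - h m.+1).
    by rewrite ltr_pM2r //; move: xz; rewrite xk -km mS; lra.
  by rewrite tE -km; lra.
have u0 : 0 < x - k%:R by rewrite subr_gt0 lt_neqAle eq_sym xk.
have : 0 < - h k.+1 * (x - k%:R) by apply: mulr_gt0 => //; lra.
have : 0 <= - h k * (1 - (x - k%:R)) by apply: mulr_ge0; lra.
lra.
Qed.

End Interpolation.

(** * Exclusion of triple points *)

(** Dividing by the lowest power leaves u modulo B, which is nonzero because u is nonzero and
    smaller than B in absolute value. *)
Lemma small_digit_neq0 (B i j k : nat) (u v w : int) :
  (i < j)%N -> (i < k)%N -> (`|u|%N < B)%N -> u != 0 ->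
  u * B%:Z ^+ i + v * B%:Z ^+ j + w * B%:Z ^+ k != 0.
Proof.
move=> ij ik uB u0; apply/eqP.
have -> : B%:Z ^+ j = B%:Z ^+ i * (B%:Z * B%:Z ^+ (j - i.+1)).
  by rewrite mulrA -exprSr -exprD subnKC.
have -> : B%:Z ^+ k = B%:Z ^+ i * (B%:Z * B%:Z ^+ (k - i.+1)).
  by rewrite mulrA -exprSr -exprD subnKC.
set p := _ ^+ (j - _); set q := _ ^+ (k - _).
have -> : u * B%:Z ^+ i + v * (B%:Z ^+ i * (B%:Z * p)) + w * (B%:Z ^+ i * (B%:Z * q))
  = B%:Z ^+ i * (u - B%:Z * (- (v * p + w * q))) by ring.
move/eqP; rewrite mulf_eq0 expf_eq0 => /orP[/andP[_]|]; first by lia.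
rewrite subr_eq0 => /eqP uE; move: uB u0; rewrite uE; set t := - _.
rewrite mulf_eq0 negb_or => + /andP[_ t0].
rewrite abszM /= ltnNge leq_pmulr ?absz_gt0 //.
Qed.

(** The determinant is a combination of three distinct powers of B whose coefficients are nonzero
    differences smaller than B in absolute value; the term of smallest exponent cannot cancel. *)
Lemma powers_not_collinear (R : realType) (B a1 a2 a3 c1 c2 c3 : nat) :
  (a1 < B)%N -> (a2 < B)%N -> (a3 < B)%N ->
  a1 != a2 -> a1 != a3 -> a2 != a3 -> c1 != c2 -> c1 != c3 -> c2 != c3 ->
  (a1%:R - a2%:R) * ((B ^ c1)%:R - (B ^ c3)%:R)
    != (a1%:R - a3%:R) * ((B ^ c1)%:R - (B ^ c2)%:R) :> R.
Proof.
move=> a1B a2B a3B a12 a13 a23 c12 c13 c23.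
have cast (m : nat) : m%:R = (m%:Z)%:~R :> R by rewrite pmulrn.
have castX c : (B ^ c)%:R = (B%:Z ^+ c)%:~R :> R by rewrite natrX rmorphXn.
rewrite !castX !cast -!rmorphB -!rmorphM /= eqr_int -subr_eq0.
set b1 := _ ^+ c1; set b2 := _ ^+ c2; set b3 := _ ^+ c3.
have -> : (a1%:Z - a2%:Z) * (b1 - b3) - (a1%:Z - a3%:Z) * (b1 - b2)
  = (a3%:Z - a2%:Z) * b1 + (a1%:Z - a3%:Z) * b2 + (a2%:Z - a1%:Z) * b3 by ring.
have [/andP[H1 H2]|[/andP[H1 H2]|/andP[H1 H2]]] :
  ((c1 < c2) && (c1 < c3) \/ (c2 < c1) && (c2 < c3) \/ (c3 < c1) && (c3 < c2))%N by lia.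
- by apply: small_digit_neq0 => //; lia.
- by rewrite [_ * b1 + _]addrC; apply: small_digit_neq0 => //; lia.
- by rewrite addrC addrA; apply: small_digit_neq0 => //; lia.
Qed.

(** The value (1 - t) a + t b is the same for the three points (a, b), so they lie on one line. *)
Lemma concurrent_collinear (R : realFieldType) (a1 a2 a3 b1 b2 b3 t : R) : t < 1 ->
  a1 + (b1 - a1) * t = a2 + (b2 - a2) * t ->
  a1 + (b1 - a1) * t = a3 + (b3 - a3) * t ->
  (a1 - a2) * (b1 - b3) = (a1 - a3) * (b1 - b2).
Proof.
move=> t1 e12 e13; have t0 : 1 - t != 0 by rewrite subr_eq0 gt_eqF.
apply: (mulfI t0).
have {}e12 : (1 - t) * (a1 - a2) = - t * (b1 - b2) by lra.
have {}e13 : (1 - t) * (a1 - a3) = - t * (b1 - b3) by lra.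
by rewrite !mulrA e12 e13; ring.
Qed.

Lemma curves_exist (R : realType) (n : nat) (s : nat -> nat -> nat -> bool) :
  signotope n s ->
  exists (F : nat * nat -> R -> R) (y : nat -> R),
  [/\ forall e, continuous (F e),
    forall e i, (e.1 < e.2 < n)%N -> (i < n)%N ->
      if on_line e i then F e i.+1%:R = y i
      else if above_line s e i then F e i.+1%:R < y i
      else y i < F e i.+1%:R,
    forall e f, (e.1 < e.2 < n)%N -> (f.1 < f.2 < n)%N -> e <> f ->
      exists2 z, F e z = F f z &
        (forall x, x < z -> F f x < F e x) /\ (forall x, z < x -> F e x < F f x) \/
        (forall x, x < z -> F e x < F f x) /\ (forall x, z < x -> F f x < F e x) &
    forall e f g x, (e.1 < e.2 < n)%N -> (f.1 < f.2 < n)%N -> (g.1 < g.2 < n)%N ->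
      e <> f -> f <> g -> e <> g -> F e x = F f x -> F e x = F g x ->
      exists2 i, x = i.+1%:R & on_line e i].
Proof.
move=> /slope_rank_exists[r rs].
(* This base exceeds every level and is at least 2, so its powers increase strictly. *)
pose B := #|{: 'I_n * 'I_n}|.+2.
pose lev k e := level n s r k e.
have levB k e : (lev k e < B)%N by rewrite ltnS leqW // max_card.
(* Powers of a large base at every other abscissa prevent three lines from
   being concurrent strictly between two abscissas. *)
pose ht k l := if odd k then (B ^ l)%N else l.
have ht_lt k l l' : (l < l')%N -> (ht k l < ht k l')%N.
  by rewrite /ht; case: odd => //; rewrite ltn_exp2l.
have ht_le k l l' : (l <= l')%N -> (ht k l <= ht k l')%N.
  by rewrite leq_eqVlt => /orP[/eqP->//|/(ht_lt k)/ltnW].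
pose h e k : R := (ht k (lev k e))%:R.
have h_inj e f k : h e k = h f k -> lev k e = lev k f.
  move=> /eqP; rewrite eqr_nat => /eqP H.
  by case: (ltngtP (lev k e) (lev k f)) => // /(ht_lt k); rewrite H ltnn.
pose F e := interp n.+1 (h e).
have F_node e i : (i < n)%N -> F e i.+1%:R = h e i.+1.
  by move=> i_n; apply: interp_node; apply: leqW.
have same k e f : (k <= n.+1)%N -> (e.1 < e.2 < n)%N -> (f.1 < f.2 < n)%N ->
    e <> f -> h e k = h f k -> tied k e f.
  move=> kn en fn /eqP ef /h_inj lev_eq; apply: contraT => nt.
  by have := level_neq rs kn en fn ef nt; rewrite -/(lev _ _) lev_eq eqxx.
exists F, (fun i => (ht i.+1 (vertex_level n s i))%:R); split.
- by move=> e; apply: interp_continuous.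
- move=> e i en i_n; rewrite F_node //; case: ifP => ei.
    by rewrite /h /lev level_on.
  have := level_off rs en i_n (negbT ei); rewrite -/(lev _ _).
  by case: ifP => _ ?; rewrite ltr_nat ht_lt.
- suff cross e f : (e.1 < e.2 < n)%N -> (f.1 < f.2 < n)%N -> (r e < r f)%N ->
      exists2 z, F e z = F f z &
        (forall x, x < z -> F f x < F e x) /\ (forall x, z < x -> F e x < F f x).
    move=> e f en fn ef; case: (ltngtP (r e) (r f)) => rr.
    + by have [z ? ?] := cross _ _ en fn rr; exists z => //; left.
    + by have [z ? ?] := cross _ _ fn en rr; exists z => //; right.
    + by case: ef; apply: (proj1 rs).
  move=> en fn rr; have [m [mn H1 H2 H3 H4]] := level_cross rs en fn rr.
  have [|||||z [z0 zl zr]] := @interp_cross R n.+1 (fun k => h e k - h f k) m.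
  + by [].
  + by move=> k /H1 km; rewrite subr_gt0 ltr_nat ht_lt.
  + by rewrite subr_le0 ler_nat ht_le.
  + by move=> k /H3 km; rewrite subr_lt0 ltr_nat ht_lt.
  + by rewrite subr_lt0 ltr_nat ht_lt.
  exists z; first by apply/eqP; rewrite -subr_eq0 interpB z0.
  split=> x.
    by move=> /zl; rewrite -interpB subr_gt0.
  by move=> /zr; rewrite -interpB subr_lt0.
move=> e f g x en fn gn ef fg eg xef xeg.
have node k : (k <= n.+1)%N -> x = k%:R -> exists2 i, x = i.+1%:R & on_line e i.
  move=> kn xk; have : tied k e f.
    by apply: same => //; move: xef; rewrite xk /F !interp_node.
  by case: k kn xk => [|k] kn xk /and3P[] // _ ke _; exists k.
(* Left of 0 and right of n.+1 the curves are constant, and no vertex at those two abscissas could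
   tie them. *)
have [x0|x0] := lerP x 0.
  have : tied 0 e f by apply: same => //; move: xef; rewrite /F !interp_left.
  by rewrite /tied.
have [xN|xN] := lerP n.+1%:R x.
  have : tied n.+1 e f by apply: same => //; move: xef; rewrite /F !interp_right.
  by case/and3P=> _; rewrite /on_line /=; move: en; lia.
have [[k kN kx]|xE] := @nat_segment R n.+1 x ltac:(by rewrite !ltW); last first.
  by move: x0; rewrite xE ltxx.
have [xk|xk] := eqVneq x k%:R; first exact: node (ltnW kN) xk.
have [xk1|xk1] := eqVneq x k.+1%:R; first exact: node kN xk1.
have kS : k.+1%:R = k%:R + 1 :> R by rewrite -natr1.
have t0 : 0 < x - k%:R by rewrite subr_gt0 lt_neqAle eq_sym xk; case/andP: kx.
have t1 : x - k%:R < 1.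
  by rewrite ltrBlDr addrC -kS lt_neqAle xk1; case/andP: kx.
have seg e' : F e' x = h e' k + (h e' k.+1 - h e' k) * (x - k%:R).
  by apply: interp_segment.
move: xef xeg; rewrite !seg; move: (x - k%:R) t0 t1 => t t0 t1 xef xeg {node seg}.
(* Curves that meet strictly inside the segment differ at both of its ends: agreement at one end
   would give agreement at the other, and the edges would share two vertices. *)
have both e' f' : (e'.1 < e'.2 < n)%N -> (f'.1 < f'.2 < n)%N -> e' <> f' ->
    h e' k + (h e' k.+1 - h e' k) * t = h f' k + (h f' k.+1 - h f' k) * t ->
    h e' k <> h f' k /\ h e' k.+1 <> h f' k.+1.
  move=> en' fn' ef' E.
  have E' : (h e' k - h f' k) * (1 - t) + (h e' k.+1 - h f' k.+1) * t = 0 by lra.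
  suff : ~ (h e' k = h f' k /\ h e' k.+1 = h f' k.+1).
    move=> H; split=> H1; apply: H; split=> //; move: E'; rewrite H1 subrr mul0r.
      by rewrite add0r => /eqP; rewrite mulf_eq0 (gt_eqF t0) orbF subr_eq0 => /eqP.
    rewrite addr0 => /eqP; rewrite mulf_eq0 subr_eq0 => /orP[/eqP//|].
    by rewrite subr_eq0 gt_eqF.
  move=> [/(same _ _ _ (ltnW kN) en' fn' ef')T1 /(same _ _ _ kN en' fn' ef')T2].
  case: e' f' en' fn' ef' T1 T2 {E E'} => a b [c d] /= ab cd ef'.
  rewrite /tied /on_line /= => T1 T2; apply: ef'.
  by congr pair; lia.
have [a12 b12] := both _ _ en fn ef xef.
have [a13 b13] := both _ _ en gn eg xeg.
have [a23 b23] := both _ _ fn gn fg (etrans (esym xef) xeg).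
have neq e' f' k' : h e' k' <> h f' k' -> lev k' e' != lev k' f'.
  by move=> H; apply/eqP => E; apply: H; rewrite /h E.
have det := concurrent_collinear t1 xef xeg.
exfalso; move: det; rewrite /h /ht /= if_neg.
(* For odd k the powers stand at k and the plain levels at k.+1, so the roles of the two ends are
   exchanged. *)
case: (odd k) => /eqP; apply/negP.
  rewrite eq_sym mulrC [X in _ != X]mulrC.
  by apply: powers_not_collinear => //; apply: neq.
by apply: powers_not_collinear => //; apply: neq.
Qed.

(** * The drawing *)

Definition is_plus (x : sign) : bool := if x is Plus then true else false.

(** Natural indices let the induction on n drop the last point; [true] is the default outside the
    range. *)
Definition nat_signs (n : nat) (sigma : 'I_n -> 'I_n -> 'I_n -> sign) (a b c : nat) : bool :=
  if (insub a, insub b, insub c) is (Some i, Some j, Some k)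
  then is_plus (sigma i j k) else true.

Lemma nat_signsE n (sigma : 'I_n -> 'I_n -> 'I_n -> sign) (i j k : 'I_n) :
  nat_signs sigma i j k = is_plus (sigma i j k).
Proof. by rewrite /nat_signs !valK. Qed.

Definition admissible (n : nat) (sigma : 'I_n -> 'I_n -> 'I_n -> sign) : Prop :=
  forall a b c d : 'I_n, (a < b)%N -> (b < c)%N -> (c < d)%N ->
     has_form sigma a b c d Plus Plus Plus Plus \/
     has_form sigma a b c d Plus Plus Plus Minus \/
     has_form sigma a b c d Plus Plus Minus Minus \/
     has_form sigma a b c d Plus Minus Minus Minus \/
     has_form sigma a b c d Minus Minus Minus Minus \/
     has_form sigma a b c d Minus Minus Minus Plus \/
     has_form sigma a b c d Minus Minus Plus Plus \/
     has_form sigma a b c d Minus Plus Plus Plus.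

Lemma admissibleP n (sigma : 'I_n -> 'I_n -> 'I_n -> sign) :
  admissible sigma <-> signotope n (nat_signs sigma).
Proof.
split=> H.
  move=> a b c d ab bc cd dn.
  have cn : (c < n)%N by lia. have bn : (b < n)%N by lia. have an : (a < n)%N by lia.
  have := H (Ordinal an) (Ordinal bn) (Ordinal cn) (Ordinal dn) ab bc cd.
  rewrite -[a]/(val (Ordinal an)) -[b]/(val (Ordinal bn)) -[c]/(val (Ordinal cn)).
  rewrite -[d]/(val (Ordinal dn)) !nat_signsE /has_form.
  by case=> [[-> -> -> ->]|[[-> -> -> ->]|[[-> -> -> ->]|[[-> -> -> ->]|
    [[-> -> -> ->]|[[-> -> -> ->]|[[-> -> -> ->]|[-> -> -> ->]]]]]]]].
move=> a b c d ab bc cd; have := H a b c d ab bc cd (ltn_ord d).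
rewrite !nat_signsE /has_form /monotone4.
by case: (sigma a b c); case: (sigma a b d); case: (sigma a c d); case: (sigma b c d);
  move=> //= _; do ?[by left|right].
Qed.

(** * Crossings of graphs of functions *)

Section Graphs.
Variable R : realType.
Implicit Types (F G : R -> R) (p q : R * R).

Lemma height_over_continuous F : continuous F -> continuous (fun p : R * R => p.2 - F p.1).
Proof.
move=> cF p; apply: cvgB; first exact: cvg_snd.
by apply: (@continuous_comp _ _ _ fst F); [exact: cvg_fst|exact: cF].
Qed.

(** The height over the graph is continuous, so on a connected set containing p and q it would
    vanish somewhere, while S avoids the graph. *)
Lemma graph_separates F (S : set (R * R)) p q : continuous F ->
  (forall z, S z -> z.2 <> F z.1) ->
  (p.2 - F p.1) * (q.2 - F q.1) < 0 -> ~ connected_component S p q.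
Proof.
move=> cF SF pq [B [Bp BS cB] Bq].
pose g (z : R * R) := z.2 - F z.1.
have cg : {within B, continuous g}.
  exact/continuous_subspaceT/height_over_continuous.
have /connected_intervalP gB := connected_continuous_connected cB cg.
suff [z Bz gz] : (g @` B) 0.
  by apply: (SF z (BS _ Bz)); apply/eqP; rewrite -subr_eq0 -/(g z) gz.
have gp : (g @` B) (g p) by exists p.
have gq : (g @` B) (g q) by exists q.
have [p0|p0] := lerP 0 (g p); have [q0|q0] := lerP 0 (g q).
- by move: pq; rewrite -/(g p) -/(g q) ltNge mulr_ge0.
- by apply: (gB _ _ gq gp); rewrite (ltW q0).
- by apply: (gB _ _ gp gq); rewrite (ltW p0).
- by move: pq; rewrite -/(g p) -/(g q) ltNge mulr_le0 // ltW.
Qed.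

Lemma strip_open (lo hi : R) : open [set p : R * R | lo < p.1 < hi].
Proof.
rewrite (_ : mkset _ = fst @^-1` `]lo, hi[%classic); last first.
  by apply/seteqP; split=> p /=; rewrite in_itv.
by apply: open_comp => [p _|]; [exact: cvg_fst|exact: interval_open].
Qed.

(** The neighbourhood is a vertical strip in which A is the graph of F; the sign change of G - F
    separates the two sides. The affine parameter serves both for arcs over the unit interval and
    for whole pseudolines. *)
Lemma graph_crosses_at F G (x0 w lo hi t : R) (A : set (R * R)) :
  continuous F -> 0 < w -> lo < x0 + t * w < hi ->
  (forall p, lo < p.1 < hi -> A p <-> p.2 = F p.1) ->
  F (x0 + t * w) = G (x0 + t * w) ->
  (forall x x', x < x0 + t * w -> x0 + t * w < x' -> (G x - F x) * (G x' - F x') < 0) ->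
  crosses_at A (fun u => (x0 + u * w, G (x0 + u * w))) t.
Proof.
move=> cF w0 /andP[lot thi] AF FG sgn; split; first by apply/AF; rewrite //= lot.
exists [set p : R * R | lo < p.1 < hi]; split.
  by apply: open_nbhs_nbhs; split; [exact: strip_open|rewrite /= lot].
pose d := Num.min (x0 + t * w - lo) (hi - (x0 + t * w)) / w.
have dw : d * w = Num.min (x0 + t * w - lo) (hi - (x0 + t * w)) by rewrite divfK // gt_eqF.
have d0 : 0 < d by rewrite divr_gt0 // lt_min !subr_gt0 lot.
have [dlo dhi] : d * w <= x0 + t * w - lo /\ d * w <= hi - (x0 + t * w).
  by rewrite dw !ge_min !lexx orbT.
exists d => // u v /andP[u1 u2] /andP[v1 v2].
have {}u1 : (t - d) * w < u * w by rewrite ltr_pM2r.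
have {}v2 : v * w < (t + d) * w by rewrite ltr_pM2r.
have {}u2 : u * w < t * w by rewrite ltr_pM2r.
have {}v1 : t * w < v * w by rewrite ltr_pM2r.
rewrite mulrBl in u1; rewrite mulrDl in v2.
have uin : lo < x0 + u * w < hi by apply/andP; split; lra.
have vin : lo < x0 + v * w < hi by apply/andP; split; lra.
have S := sgn (x0 + u * w) (x0 + v * w) ltac:(lra) ltac:(lra).
split.
- by split=> // /AF /= => /(_ uin) E; move: S; rewrite E subrr mul0r ltxx.
- by split=> // /AF /= => /(_ vin) E; move: S; rewrite E subrr mulr0 ltxx.
- by apply: (@graph_separates F) => // z [zin zA] zF; apply: zA; apply/AF.
Qed.

Lemma graph_pseudoline F : continuous F -> is_pseudoline (fun x => (x, F x)).
Proof.
move=> cF; split.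
- move=> x; apply: (@cvg_pair _ _ _ _ (nbhs x) (nbhs (F x)) _ _ _ id F);
    [exact: cvg_id|exact: cF].
- by move=> x y [].
- have le x : x <= `|(x, F x)| by rewrite prod_normE le_max ler_norm.
  by apply: (ger_cvgy _ cvg_id); near=> x.
- have le x : - x <= `|(x, F x)| by rewrite prod_normE le_max -normrN ler_norm.
  apply: (@ger_cvgy _ _ _ _ (fun x : R => - x)); first by near=> x.
  by rewrite ninftyN.
Unshelve. all: by end_near.
Qed.

End Graphs.

(* The closed arc for [i = true], the open one for [i = false]. *)
Lemma graph_arc_image (R : realType) (F : R -> R) (x x' : R) (p : R * R) (i : bool) : x < x' ->
  ((fun t => (x + t * (x' - x), F (x + t * (x' - x)))) @`
      [set` Interval (BSide i 0) (BSide (~~ i) 1)]) p <->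
  (p.1 \in Interval (BSide i x) (BSide (~~ i) x')) /\ p.2 = F p.1.
Proof.
move=> xx; have w0 : 0 < x' - x by rewrite subr_gt0.
have aff t : (x + t * (x' - x) \in Interval (BSide i x) (BSide (~~ i) x')) =
    (t \in Interval (BSide i 0) (BSide (~~ i) 1)).
  have -> : (x + t * (x' - x) \in Interval (BSide i x) (BSide (~~ i) x')) =
      (x + t * (x' - x) \in Interval (BSide i (x + 0 * (x' - x)))
         (BSide (~~ i) (x + 1 * (x' - x)))) by rewrite mul0r addr0 mul1r subrKC.
  case: i; rewrite !in_itv /=; first by rewrite !lerD2l !ler_pM2r.
  by rewrite !ltrD2l !ltr_pM2r.
split=> [[t ti <-]|[pi pF]] /=; first by rewrite aff.
have pE : x + (p.1 - x) / (x' - x) * (x' - x) = p.1 by rewrite divfK ?gt_eqF // addrC subrK.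
exists ((p.1 - x) / (x' - x)); first by rewrite /= -aff pE.
by rewrite pE -pF -surjective_pairing.
Qed.

Lemma drawing_of_curves (R : realType) (n : nat)
    (sigma : 'I_n -> 'I_n -> 'I_n -> sign) :
  signotope n (nat_signs sigma) ->
  exists D : drawing_data R n,
    is_drawing D /\ x_monotone D /\ pseudolinear D /\ realizes D sigma.
Proof.
move=> /(curves_exist R)[F [y [F_cont F_vertex F_cross F_triple]]].
pose X (i : 'I_n) : R := i.+1%:R.
have X_lt (i j : 'I_n) : (i < j)%N -> X i < X j by rewrite ltr_nat.
pose E (e : 'I_n * 'I_n) := F (npair e).
pose D := @DrawingData R n (fun i => (X i, y i))
  (fun e t => (X e.1 + t * (X e.2 - X e.1), E e (X e.1 + t * (X e.2 - X e.1)))).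
have E_edge (e : 'I_n * 'I_n) : is_edge e -> ((npair e).1 < (npair e).2 < n)%N.
  by rewrite /is_edge /= => ->; apply: ltn_ord.
have W0 e : is_edge e -> 0 < X e.2 - X e.1 by move=> H; rewrite subr_gt0 X_lt.
have edgeP e p : is_edge e -> edge_set D e p <-> X e.1 <= p.1 <= X e.2 /\ p.2 = E e p.1.
  by move=> H; have := @graph_arc_image R (E e) _ _ p true (X_lt _ _ H); rewrite in_itv.
have interiorP e p : is_edge e ->
    edge_interior D e p <-> X e.1 < p.1 < X e.2 /\ p.2 = E e p.1.
  by move=> H; have := @graph_arc_image R (E e) _ _ p false (X_lt _ _ H); rewrite in_itv.
have E_on e i : is_edge e -> i = e.1 \/ i = e.2 -> E e (X i) = y i.
  move=> H ie; have := F_vertex _ i (E_edge _ H) (ltn_ord i).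
  by rewrite /on_line /=; case: ie => ->; rewrite eqxx ?orbT.
have npair_neq (e f : 'I_n * 'I_n) : e <> f -> npair e <> npair f.
  by case: e f => [a b] [c d] ef [/val_inj ? /val_inj ?]; apply: ef; congr pair.
have E_cross e f : is_edge e -> is_edge f -> e <> f ->
    exists2 z, E e z = E f z &
      (forall x, E e x = E f x -> x = z) /\
      (forall x x', x < z -> z < x' -> (E e x - E f x) * (E e x' - E f x') < 0).
  move=> He Hf ef; have [z zE zS] := F_cross _ _ (E_edge _ He) (E_edge _ Hf) (npair_neq _ _ ef).
  exists z => //; split=> [x xE|x x' xz zx'].
    case: (ltgtP x z) => // xz; exfalso; move: xE; rewrite /E => xE.
      by case: zS => -[/(_ _ xz) + _]; rewrite xE ltxx.
    by case: zS => -[_ /(_ _ xz) +]; rewrite xE ltxx.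
  by case: zS => -[/(_ _ xz) H1 /(_ _ zx') H2]; [rewrite pmulr_rlt0|rewrite nmulr_rlt0];
    rewrite ?subr_gt0 ?subr_lt0.
have crosses e f x0 w lo hi t (A : set (R * R)) : is_edge e -> is_edge f -> e <> f ->
    0 < w -> lo < x0 + t * w < hi -> (forall p, lo < p.1 < hi -> A p <-> p.2 = E f p.1) ->
    E e (x0 + t * w) = E f (x0 + t * w) ->
    crosses_at A (fun u => (x0 + u * w, E e (x0 + u * w))) t.
  move=> He Hf ef w0 lohi AE tE; have [z zE [z_uniq z_sign]] := E_cross _ _ He Hf ef.
  apply: (graph_crosses_at (F_cont _) w0 lohi AE) => //.
  by rewrite (z_uniq _ tE).
exists D; split; last split; last split.
- split.
  + by move=> i j [/eqP]; rewrite eqr_nat eqSS => /eqP/val_inj.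
  + move=> e He; apply: continuous_subspaceT => t.
    have affC : {for t, continuous (fun t : R => X e.1 + t * (X e.2 - X e.1))}.
      by apply: cvgD; [exact: cvg_cst|apply: cvgM; [exact: cvg_id|exact: cvg_cst]].
    have [gC _ _ _] := graph_pseudoline (F_cont (npair e)).
    exact: (continuous_comp affC (gC _)).
  + move=> e He t u _ _ [/addrI/mulIf H _]; apply: H.
    by rewrite gt_eqF // W0.
  + move=> e He /=; rewrite mul0r addr0 mul1r subrKC.
    by rewrite !E_on; auto.
  + move=> e k He /(edgeP _ _ He) /= [/andP[]].
    rewrite !ler_nat !ltnS => ek ke yE.
    have := F_vertex _ k (E_edge _ He) (ltn_ord k); rewrite /on_line /=.
    case: ifP => [/orP[]/eqP/val_inj|_]; [by left|by right|].
    by rewrite -/(X k) -/(E e) -yE ltxx if_same.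
  + move=> e f He Hf ef; have [z _ [z_uniq _]] := E_cross _ _ He Hf ef.
    apply: (@sub_finite_set _ _ [set (z, E e z)]); last exact: finite_set1.
    move=> [p1 p2] [/(edgeP _ _ He)[_ /= ->] /(edgeP _ _ Hf)[_ /= pE]].
    by rewrite (z_uniq _ pE).
  + move=> e f t He Hf ef t01 /(interiorP _ _ Hf) /= [tf tE].
    apply: (crosses _ f _ _ (X f.1) (X f.2)) => //; first exact: W0.
    move=> p /andP[p1 p2]; split=> [/(edgeP _ _ Hf)[]//|pE].
    by apply/(edgeP _ _ Hf); rewrite !ltW.
  + move=> e f g He Hf Hg ef fg eg; apply/seteqP; split=> // -[p1 p2].
    case=> -[/(interiorP _ _ He)/= [pin pe] /(interiorP _ _ Hf)/= [_ pf]].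
    case/(interiorP _ _ Hg)=> /= _ pg.
    (* A common point of the three curves would have the abscissa of an end of e, hence would not
       lie on the open arc. *)
    have [] := F_triple _ _ _ p1 (E_edge _ He) (E_edge _ Hf) (E_edge _ Hg)
      (npair_neq _ _ ef) (npair_neq _ _ fg) (npair_neq _ _ eg);
      [by rewrite -/(E e) -/(E f) -pe|by rewrite -/(E e) -/(E g) -pe|].
    move=> i p1E; move: pin; rewrite p1E /on_line => /andP[].
    by rewrite !ltr_nat !ltnS => H1 H2 /orP[]/eqP iE; move: H1 H2; rewrite iE ltnn.
- split=> [i j ij /eqP|e He p q /(edgeP _ _ He)[_ pE] /(edgeP _ _ He)[_ qE] pq].
    by rewrite /= eqr_nat eqSS => /eqP/val_inj.
  by rewrite (surjective_pairing p) (surjective_pairing q) pE qE pq.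
- exists (fun e x => (x, E e x)); split.
    move=> e He; split; first exact/graph_pseudoline/F_cont.
    by move=> p /(edgeP _ _ He)[_ pE]; exists p.1 => //; rewrite -pE -surjective_pairing.
  move=> e f He Hf ef; have [z zE [z_uniq _]] := E_cross _ _ He Hf ef.
  exists z; split; last by move=> x [x' _ [-> xE]]; apply: z_uniq.
  rewrite (_ : (fun x => (x, E e x)) = fun x => (0 + x * 1, E e (0 + x * 1))); last first.
    by apply/funext => x; rewrite add0r mulr1.
  apply: (crosses _ f _ _ (z - 1) (z + 1)) => //.
  - by rewrite add0r mulr1; apply/andP; split; lra.
  - move=> p _; split=> [[x _ <-]//|pE].
    by exists p.1 => //; rewrite -pE -surjective_pairing.
  - by rewrite add0r mulr1.
split=> [i j ij|i j k ij jk]; first exact: X_lt.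
have He : is_edge (i, k) by apply: ltn_trans ij jk.
have := F_vertex _ j (E_edge _ He) (ltn_ord j).
have -> : on_line (npair (i, k)) j = false.
  by apply/negbTE; rewrite negb_or gtn_eqF // ltn_eqF.
have -> : above_line (nat_signs sigma) (npair (i, k)) j = ~~ is_plus (sigma i j k).
  rewrite /above_line /=; case: (ltngtP i j) ij => // _ _.
  by case: (ltngtP j k) jk => // _ _; rewrite nat_signsE.
rewrite /signature.
have -> : `[< lies_above (vertex D j) (edge_set D (i, k)) >] = (E (i, k) (X j) < y j).
  apply/asboolP/idP => [[[q1 q2] [/(edgeP _ _ He)[_ /= ->] /= -> //]]|H].
  exists (X j, E (i, k) (X j)); split=> //; apply/(edgeP _ _ He); split=> //=.
  by rewrite !ltW // X_lt.
rewrite /E /npair /=; case: (sigma i j k) => /=; last by move=> ->.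
by case: ltgtP.
Qed.

(** * Arcs and pseudolines *)

Section Curves.
Variable R : realType.

(** The abscissa along g is continuous and injective, hence increasing with a continuous inverse. F
    is the ordinate after this inverse, extended to the whole line by clamping. *)
Lemma monotone_arc_graph (g : R -> R * R) :
  {within `[0, 1], continuous g} ->
  {in `[0, 1] &, injective (fun t => (g t).1)} -> (g 0).1 < (g 1).1 ->
  exists2 F : R -> R, continuous F &
    forall p, (g @` `[0, 1]) p <-> (g 0).1 <= p.1 <= (g 1).1 /\ p.2 = F p.1.
Proof.
move=> cg g_inj g01.
pose g1 t := (g t).1.
have cg1 : {within `[0, 1], continuous g1}.
  by move=> x; apply: (continuous_comp (cg x)); apply: cvg_fst.
pose inv x := xget 0 [set t | t \in `[0, 1] /\ g1 t = x].
have g1K : {in `[0, 1], cancel g1 inv}.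
  move=> t t01; rewrite /inv; case: xgetP => [u _ [u01 /g_inj ->]//|/(_ t)].
  by case; split.
have cinv := segment_can_le_continuous ler01 cg1 g1K.
have g1_mono := segment_continuous_inj_le (ltW g01) cg1 g_inj.
have g1_itv t : t \in `[0, 1] -> (g 0).1 <= g1 t <= (g 1).1.
  move=> t01; move: (t01); rewrite in_itv /= => /andP[t0 t1].
  by rewrite -[(g 0).1]/(g1 0) -[(g 1).1]/(g1 1) !g1_mono ?t0 ?in_itv //= ?lexx ?ler01.
have g1_surj x : (g 0).1 <= x <= (g 1).1 -> exists2 t, t \in `[0, 1] & g1 t = x.
  move=> xin; apply: (@IVT R g1 0 1 x ler01 cg1).
  by rewrite (min_idPl (ltW g01)) (max_idPr (ltW g01)).
pose F x := ((g \o clamp 0 1) ((inv \o clamp (g 0).1 (g 1).1) x)).2.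
have F_g t : t \in `[0, 1] -> F (g1 t) = (g t).2.
  move=> t01; rewrite /F /= (@clamp_id R (g 0).1 (g 1).1 (g1 t)) ?g1K ?clamp_id //.
  by rewrite in_itv /= g1_itv.
exists F.
  move=> x; apply: (@continuous_comp _ _ _
    (fun x => (g \o clamp 0 1) ((inv \o clamp (g 0).1 (g 1).1) x)) snd); last exact: cvg_snd.
  apply: continuous_comp; first exact: (continuous_clamped (ltW g01) cinv).
  exact: (continuous_clamped ler01 cg).
move=> p; split=> [[t t01 <-]|[/g1_surj[t t01 tp] pF]].
  by split; [exact: g1_itv|rewrite F_g].
by exists t => //; rewrite [p]surjective_pairing pF -tp F_g // -surjective_pairing.
Qed.

Lemma pseudoline_opp (l : R -> R * R) : is_pseudoline l -> is_pseudoline (l \o -%R).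
Proof.
case=> cl il ly lN; split.
- by move=> x; apply: continuous_comp; [exact: oppr_continuous|exact: cl].
- by move=> x y /il/oppr_inj.
- exact: ((proj1 (cvgNy_compNP _ _)) lN).
- exact: ((proj1 (cvgy_compNP _ _)) ly).
Qed.

(** Outside a compact parameter interval the pseudoline is farther out than the bounded arc. On that
    interval l maps closed sets to closed sets, which makes the lifted parameter continuous. *)
Lemma pseudoline_param (l g : R -> R * R) : is_pseudoline l ->
  {within `[0, 1], continuous g} -> (forall t, t \in `[0, 1] -> range l (g t)) ->
  exists2 phi : R -> R, {within `[0, 1], continuous phi} &
    forall t, t \in `[0, 1] -> l (phi t) = g t.
Proof.
case=> cl il ly lN cg gl.
pose h := g \o clamp 0 1.
have ch : continuous h := continuous_clamped ler01 cg.
have hl t : exists s, l s == h t.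
  by have [s _ ls] := gl _ (clamp_itv t ler01); exists s; apply/eqP.
pose phi t := xchoose (hl t).
have phiE t : l (phi t) = h t by apply/eqP/(xchooseP (hl t)).
exists phi; last by move=> t t01; rewrite phiE /h /= clamp_id.
apply: continuous_subspaceT.
have [M hM] : exists M, forall t, `|h t| <= M.
  have := compact_bounded (continuous_compact cg (@segment_compact R 0 1)).
  case=> M [_ HM]; exists (M + 1) => t; apply: HM; first by rewrite ltrDl.
  by exists (clamp 0 1 t) => //; apply: clamp_itv.
have [S1 [_ HS1]] : \forall s \near +oo, M < `|l s| by exact: (proj1 (cvgryPgt _) ly M).
have [S2 [_ HS2]] : \forall s \near -oo, M < `|l s| by exact: (proj1 (cvgryPgt _) lN M).
have phi_itv t : phi t \in `[S2, S1].
  rewrite in_itv /= !leNgt; apply/andP; split; apply/negP.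
    by move=> /HS2; rewrite phiE ltNge hM.
  by move=> /HS1; rewrite phiE ltNge hM.
apply/continuous_closedP => B cB.
have -> : phi @^-1` B = h @^-1` (l @` (B `&` `[S2, S1])).
  apply/seteqP; split=> t /=.
    by move=> Bt; exists (phi t) => //; split=> //; apply: phi_itv.
  by move=> [s [Bs _]]; rewrite -phiE => /il <-.
apply: closed_comp => [t _|]; first exact: ch.
apply: compact_closed; first exact: norm_hausdorff.
apply: continuous_compact; first exact: continuous_subspaceT.
by rewrite setIC; apply: compact_closedI => //; apply: segment_compact.
Qed.

End Curves.

(** * Rays of pseudolines and bounded regions *)

Section Rays.
Variable R : realType.

Lemma pseudoline_ray (l g : R -> R * R) : is_pseudoline l ->
  {within `[0, 1], continuous g} -> {in `[0, 1] &, injective g} ->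
  g @` `[0, 1] `<=` range l ->
  exists C : set (R * R), [/\ connected C, C (g 0), C `<=` range l,
    forall M, exists2 p, C p & M < `|p| &
    forall p, C p -> (g @` `[0, 1]) p -> p = g 0].
Proof.
move=> + cg g_inj.
have i0 : (0 : R) \in `[0, 1] by rewrite in_itv /= lexx ler01.
have i1 : (1 : R) \in `[0, 1] by rewrite in_itv /= lexx ler01.
(* Reversing l if needed makes its parameter increase along g; the ray then consists of the
   parameters up to [phi 0]. *)
wlog : l / exists2 phi : R -> R, {within `[0, 1], continuous phi} /\ phi 0 <= phi 1 &
    forall t, t \in `[0, 1] -> l (phi t) = g t.
  move=> IH ll gl.
  have [phi cphi phiE] := pseudoline_param ll cg
    (fun t t01 => gl _ (imageP g t01)).
  have [phi01|phi10] := leP (phi 0) (phi 1); first by apply: (IH l) => //; exists phi.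
  have rangeN : range (l \o -%R) = range l.
    apply/seteqP; split=> _ [x _ <-]; first by exists (- x).
    by exists (- x) => //=; rewrite opprK.
  rewrite -rangeN in gl *; apply: IH => //; last exact: pseudoline_opp.
  exists (fun t => - phi t); last by move=> t t01; rewrite /= opprK phiE.
  split; last by rewrite lerN2 ltW.
  by move=> x; apply: continuousN; apply: cphi.
case=> phi [cphi phi01] phiE [cl il _ lN] gl.
have phi_inj : {in `[0, 1] &, injective phi}.
  by move=> t u t01 u01 tu; apply: g_inj => //; rewrite -!phiE // tu.
have phi_mono := segment_continuous_inj_le phi01 cphi phi_inj.
exists (l @` `]-oo, phi 0]%classic); split.
- apply: connected_continuous_connected; last exact: continuous_subspaceT.
  by apply/connected_intervalP/interval_is_interval.
- by exists (phi 0); [rewrite /= in_itv /= lexx|rewrite phiE].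
- by move=> _ [x _ <-]; exists x.
- move=> M; have [S [_ HS]] : \forall s \near -oo, M < `|l s|.
    exact: (proj1 (cvgryPgt _) lN M).
  exists (l (Num.min (phi 0) (S - 1))); last by apply: HS; rewrite gt_min ltrBlDr ltrDl ltr01 orbT.
  by exists (Num.min (phi 0) (S - 1)) => //; rewrite /= in_itv /= ge_min lexx.
move=> p [s + <-] [t t01]; rewrite /= in_itv /= => s0; rewrite -phiE // => /il ts.
move: s0; rewrite -ts phi_mono // phiE // => t0; congr g; apply/le_anti; rewrite t0.
by move: t01; rewrite /= in_itv /= => /andP[].
Qed.

(** If C misses the boundary, the open region [T] and the closed region [K] have the same trace on
    C, since the two graphs meet above a and d. By connectedness C then stays in [T], which is
    bounded. *)
Lemma unbounded_escapes (lo hi : R -> R) (a d : R) (C : set (R * R)) (p0 : R * R) :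
  continuous lo -> continuous hi -> a <= d -> lo a = hi a -> lo d = hi d ->
  connected C -> (forall M, exists2 p, C p & M < `|p|) ->
  C p0 -> a < p0.1 < d -> lo p0.1 < p0.2 < hi p0.1 ->
  exists2 p, C p & a <= p.1 <= d /\ (p.2 = lo p.1 \/ p.2 = hi p.1).
Proof.
move=> clo chi ad loa lod cC Cinf Cp0 p0a p0lo; apply: contrapT => Nex.
pose gl (p : R * R) := p.2 - lo p.1.
pose gh (p : R * R) := p.2 - hi p.1.
have cgl : continuous gl by apply: height_over_continuous.
have cgh : continuous gh by apply: height_over_continuous.
pose T := [set p : R * R | a < p.1 < d] `&` (gl @^-1` `]0, +oo[ `&` gh @^-1` `]-oo, 0[).
pose K := fst @^-1` `[a, d] `&` (gl @^-1` `[0, +oo[ `&` gh @^-1` `]-oo, 0]).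
have oT : open T.
  apply: openI; first exact: strip_open.
  by apply: openI; apply: open_comp.
have cK : closed K.
  apply: closedI; first by apply: closed_comp => [p _|]; [exact: cvg_fst|exact: interval_closed].
  by apply: closedI; apply: closed_comp => // *; exact: interval_closed.
have TE p : T p <-> a < p.1 < d /\ lo p.1 < p.2 < hi p.1.
  rewrite /T /= !in_itv /= andbT subr_gt0 subr_lt0.
  by split=> [[-> [-> ->]]|[-> /andP[-> ->]]].
have KE p : K p <-> a <= p.1 <= d /\ lo p.1 <= p.2 <= hi p.1.
  rewrite /K /= !in_itv /= andbT subr_ge0 subr_le0.
  by split=> [[-> [-> ->]]|[-> /andP[-> ->]]].
have CT : C `&` T = C.
  apply: cC; [by exists p0; split=> //; apply/TE|by exists T|exists K => //].
  apply/seteqP; split=> p [Cp].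
    move=> /TE[/andP[p1 p2] /andP[p3 p4]]; split=> //.
    by apply/KE; rewrite !ltW.
  move=> /KE[/andP[p1 p2] /andP[p3 p4]]; split=> //.
  have Nlo : p.2 <> lo p.1 by move=> E; apply: Nex; exists p => //; rewrite p1 p2; auto.
  have Nhi : p.2 <> hi p.1 by move=> E; apply: Nex; exists p => //; rewrite p1 p2; auto.
  apply/TE; rewrite !lt_neqAle p1 p2 p3 p4 !andbT; split; apply/andP; split; apply/eqP.
  - by move=> E; apply: Nlo; apply/le_anti; rewrite p3 -E loa E p4.
  - by move=> E; apply: Nlo; apply/le_anti; rewrite p3 E lod -E p4.
  - by move=> E; apply: Nlo.
  - by [].
have [u _ uM] := EVT_max ad (continuous_subspaceT chi).
have [v _ vM] := EVT_min ad (continuous_subspaceT clo).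
have [p] := Cinf (`|a| + `|d| + `|hi u| + `|lo v|).
rewrite -CT => -[_ /TE[/andP[p1 p2] /andP[p3 p4]]].
have pad : p.1 \in `[a, d] by rewrite in_itv /= !ltW.
have pu := uM _ pad; have pv := vM _ pad.
have N := (ler_norm a, ler_norm (- a), ler_norm d, ler_norm (- d),
  ler_norm (hi u), ler_norm (- hi u), ler_norm (lo v), ler_norm (- lo v)).
rewrite !normrN in N; case: N => [[[[[[[N1 N2] N3] N4] N5] N6] N7] N8].
rewrite prod_normE ltNge => /negP; apply.
have [Na Nd Nh Nl] : [/\ 0 <= `|a|, 0 <= `|d|, 0 <= `|hi u| & 0 <= `|lo v|] by [].
by rewrite ge_max !ler_norml; apply/andP; split; apply/andP; split; lra.
Qed.

End Rays.

(** * Forbidden forms *)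

Section PseudolinearDrawings.
Variables (R : realType) (n : nat) (D : drawing_data R n).
Hypotheses (D_drawing : is_drawing D) (D_mono : x_monotone D).
Hypothesis D_labelled : labelled_by_x D.
Variable l : 'I_n * 'I_n -> R -> R * R.
Hypothesis l_line : forall e, is_edge e ->
  is_pseudoline (l e) /\ edge_set D e `<=` range (l e).
Hypothesis l_cross : forall e f, is_edge e -> is_edge f -> e <> f ->
  exists t : R, crosses_at (range (l f)) (l e) t /\
    forall t' : R, range (l f) (l e t') -> t' = t.

Let X (i : 'I_n) : R := (vertex D i).1.

Lemma edge_graph e : is_edge e -> exists F : R -> R,
  continuous F /\
  forall p, edge_set D e p <-> X e.1 <= p.1 <= X e.2 /\ p.2 = F p.1.
Proof.
move=> He; have [e0 e1] := arc_endpoints D_drawing He.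
have [||| F cF FE] := @monotone_arc_graph R (Defs.arc D e).
- exact: (arc_continuous D_drawing He).
- move=> t u t01 u01 tu; apply: (arc_simple D_drawing He); rewrite ?inE //.
  by apply: (proj2 D_mono _ He) => //; [exists t|exists u].
- by rewrite e0 e1; apply: D_labelled.
by exists F; split=> // p; rewrite /X -e0 -e1; apply: FE.
Qed.

Lemma lines_meet_once e f p q : is_edge e -> is_edge f -> e <> f ->
  range (l e) p -> range (l f) p -> range (l e) q -> range (l f) q -> p = q.
Proof.
move=> He Hf ef [t _ <-] ft [u _ <-] fu.
by have [v [_ uniq]] := l_cross He Hf ef; rewrite (uniq t) // (uniq u).
Qed.

Lemma edges_meet_once e f p q : is_edge e -> is_edge f -> e <> f ->
  edge_set D e p -> edge_set D f p -> edge_set D e q -> edge_set D f q -> p = q.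
Proof.
move=> He Hf ef ep fp eq fq.
have [[_ Le] [_ Lf]] := (l_line He, l_line Hf).
by apply: (lines_meet_once He Hf ef); [exact: Le|exact: Lf|exact: Le|exact: Lf].
Qed.

Lemma edge_ends e : is_edge e -> edge_set D e (vertex D e.1) /\ edge_set D e (vertex D e.2).
Proof.
move=> He; have [<- <-] := arc_endpoints D_drawing He.
by split; [exists 0|exists 1] => //; rewrite /= in_itv /= lexx ler01.
Qed.

(** The vertex is not on the edge, so not being above it means being strictly below. *)
Lemma signature_height (i j k : 'I_n) (F : R -> R) : (i < j)%N -> (j < k)%N ->
  (forall p, edge_set D (i, k) p <-> X i <= p.1 <= X k /\ p.2 = F p.1) ->
  if signature D i j k is Plus then (vertex D j).2 < F (X j) else F (X j) < (vertex D j).2.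
Proof.
move=> ij jk FE.
have He : is_edge (i, k) by apply: ltn_trans ij jk.
have jin : X i <= X j <= X k by rewrite !ltW // D_labelled.
have Nv : (vertex D j).2 <> F (X j).
  move=> E; have /(arc_avoids_vertices D_drawing He)[/= ji|/= jk'] : edge_set D (i, k) (vertex D j).
  - exact/FE.
  - by move: ij; rewrite ji ltnn.
  - by move: jk; rewrite jk' ltnn.
rewrite /signature; case: asboolP => [[q [/FE[_ ->] ->]]|H] //.
case: (ltgtP (vertex D j).2 (F (X j))) => // Fj; exfalso; apply: H.
by exists (X j, F (X j)); split=> //; apply/FE.
Qed.

Lemma ivt_meet e f (F G : R -> R) u v : is_edge e -> is_edge f ->
  continuous F -> continuous G ->
  (forall p, edge_set D e p <-> X e.1 <= p.1 <= X e.2 /\ p.2 = F p.1) ->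
  (forall p, edge_set D f p <-> X f.1 <= p.1 <= X f.2 /\ p.2 = G p.1) ->
  u <= v -> X e.1 <= u -> v <= X e.2 -> X f.1 <= u -> v <= X f.2 ->
  F u <= G u -> G v <= F v ->
  exists z, [/\ u <= z <= v, F z = G z, edge_set D e (z, F z) & edge_set D f (z, F z)].
Proof.
move=> He Hf cF cG FE GE uv eu ve fu vf FGu GFv.
have cFG : {within `[u, v], continuous (fun x => F x - G x)}.
  by apply: continuous_subspaceT => x; apply: cvgB; [exact: cF|exact: cG].
have [|z] := @IVT R _ u v 0 uv cFG.
  by rewrite ge_min subr_le0 FGu /= le_max !subr_ge0 GFv orbT.
rewrite in_itv /= => /andP[uz zv] /eqP; rewrite subr_eq0 => /eqP FGz.
exists z; split=> //; first by rewrite uz.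
  by apply/FE; rewrite /= (le_trans eu uz) (le_trans zv ve).
by apply/GE; rewrite /= FGz (le_trans fu uz) (le_trans zv vf).
Qed.

(** Otherwise ac and ad would exchange their vertical order between b and c and meet there, to the
    right of their common end a. *)
Lemma monotone_at_left (a b c d : 'I_n) : (a < b)%N -> (b < c)%N -> (c < d)%N ->
  signature D a b c = signature D a c d -> signature D a b d = signature D a b c.
Proof.
move=> ab bc cd.
have Hc : is_edge (a, c) by apply: ltn_trans ab bc.
have Hd : is_edge (a, d) by apply: ltn_trans (ltn_trans ab bc) cd.
have [F [cF FE]] := edge_graph Hc; have [G [cG GE]] := edge_graph Hd.
have [Xab Xbc Xcd] : [/\ X a < X b, X b < X c & X c < X d] by split; apply: D_labelled.
have Fc : (vertex D c).2 = F (X c) by have [_ /FE[_]] := edge_ends Hc.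
have Sb := signature_height ab bc FE; have Sb' := signature_height ab (ltn_trans bc cd) GE.
have Sc := signature_height (ltn_trans ab bc) cd GE.
have absurd z : X b <= z <= X c -> edge_set D (a, c) (z, F z) -> ~ edge_set D (a, d) (z, F z).
  move=> /andP[bz _] zc zd.
  have ne : (a, c) <> (a, d) by case=> cd'; move: cd; rewrite cd' ltnn.
  have := edges_meet_once Hc Hd ne zc zd (proj1 (edge_ends Hc)) (proj1 (edge_ends Hd)).
  by move=> /(congr1 fst) /= zE; move: bz; rewrite zE leNgt Xab.
move=> bcE; rewrite -bcE in Sc; move: Sb Sc Sb'.
case: (signature D a b c) => Sb Sc; case: (signature D a b d) => // Sb'; exfalso.
  have [|||||||z [zbc Gz zG zF]] := @ivt_meet (a, d) (a, c) G F (X b) (X c)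
      Hd Hc cG cF GE FE; try by rewrite /=; lra.
  by apply: (absurd z) => //; rewrite -Gz.
have [|||||||z [zbc Fz zF zG]] := @ivt_meet (a, c) (a, d) F G (X b) (X c)
      Hc Hd cF cG FE GE; try by rewrite /=; lra.
exact: (absurd z).
Qed.

(** The mirror argument: bd and ad would meet between b and c, to the left of their common end d. *)
Lemma monotone_at_right (a b c d : 'I_n) : (a < b)%N -> (b < c)%N -> (c < d)%N ->
  signature D a b d = signature D b c d -> signature D a c d = signature D b c d.
Proof.
move=> ab bc cd.
have Hb : is_edge (b, d) by apply: ltn_trans bc cd.
have Ha : is_edge (a, d) by apply: ltn_trans (ltn_trans ab bc) cd.
have [F [cF FE]] := edge_graph Hb; have [G [cG GE]] := edge_graph Ha.
have [Xab Xbc Xcd] : [/\ X a < X b, X b < X c & X c < X d] by split; apply: D_labelled.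
have Fb : (vertex D b).2 = F (X b) by have [/FE[_]] := edge_ends Hb.
have Sc := signature_height bc cd FE; have Sb := signature_height ab (ltn_trans bc cd) GE.
have Sc' := signature_height (ltn_trans ab bc) cd GE.
have absurd z : X b <= z <= X c -> edge_set D (b, d) (z, F z) -> ~ edge_set D (a, d) (z, F z).
  move=> /andP[_ zc] zb za.
  have ne : (b, d) <> (a, d) by case=> ba; move: ab; rewrite ba ltnn.
  have := edges_meet_once Hb Ha ne zb za (proj2 (edge_ends Hb)) (proj2 (edge_ends Ha)).
  by move=> /(congr1 fst) /= zE; move: zc; rewrite zE leNgt Xcd.
move=> bcE; rewrite bcE in Sb; move: Sc Sb Sc'.
case: (signature D b c d) => Sc Sb; case: (signature D a c d) => // Sc'; exfalso.
  have [|||||||z [zbc Fz zF zG]] := @ivt_meet (b, d) (a, d) F G (X b) (X c)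
      Hb Ha cF cG FE GE; try by rewrite /=; lra.
  exact: (absurd z).
have [|||||||z [zbc Gz zG zF]] := @ivt_meet (a, d) (b, d) G F (X b) (X c)
      Ha Hb cG cF GE FE; try by rewrite /=; lra.
by apply: (absurd z) => //; rewrite -Gz.
Qed.

Lemma crossing_not_enclosed (a b c d : 'I_n) : (a < b)%N -> (b < c)%N -> (c < d)%N ->
  signature D a b c = signature D b c d -> signature D a b d = signature D a b c.
Proof.
move=> ab bc cd.
have Hac : is_edge (a, c) by apply: ltn_trans ab bc.
have Hbd : is_edge (b, d) by apply: ltn_trans bc cd.
have Had : is_edge (a, d) by apply: ltn_trans (ltn_trans ab bc) cd.
have [F1 [cF1 F1E]] := edge_graph Hac; have [F2 [cF2 F2E]] := edge_graph Hbd.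
have [F0 [cF0 F0E]] := edge_graph Had.
have [Xab Xbc Xcd] : [/\ X a < X b, X b < X c & X c < X d] by split; apply: D_labelled.
have F2b : (vertex D b).2 = F2 (X b) by have [/F2E[_]] := edge_ends Hbd.
have F2d : (vertex D d).2 = F2 (X d) by have [_ /F2E[_]] := edge_ends Hbd.
have F1a : (vertex D a).2 = F1 (X a) by have [/F1E[_]] := edge_ends Hac.
have F1c : (vertex D c).2 = F1 (X c) by have [_ /F1E[_]] := edge_ends Hac.
have F0a : (vertex D a).2 = F0 (X a) by have [/F0E[_]] := edge_ends Had.
have F0d : (vertex D d).2 = F0 (X d) by have [_ /F0E[_]] := edge_ends Had.
have S1 := signature_height ab bc F1E; have S2 := signature_height bc cd F2E.
have S0 := signature_height ab (ltn_trans bc cd) F0E.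
move=> bcE; rewrite -bcE in S2.
(* Equal signs of abc and bcd put bd and ac in opposite vertical orders at b and at c. *)
have [z [zbc Fz z1 z2]] : exists z, [/\ X b <= z <= X c, F1 z = F2 z,
    edge_set D (a, c) (z, F1 z) & edge_set D (b, d) (z, F1 z)].
  move: S1 S2; case: (signature D a b c) => S1 S2.
    have [|||||||z [zbc Fz z2 z1]] := @ivt_meet (b, d) (a, c) F2 F1 (X b) (X c)
      Hbd Hac cF2 cF1 F2E F1E; try by rewrite /=; lra.
    by exists z; rewrite -Fz.
  have [|||||||z [zbc Fz z1 z2]] := @ivt_meet (a, c) (b, d) F1 F2 (X b) (X c)
      Hac Hbd cF1 cF2 F1E F2E; try by rewrite /=; lra.
  by exists z.
have zb : z <> X b.
  by move=> zE; move: S1; rewrite F2b -zE Fz; case: signature; rewrite ltxx.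
case/andP: zbc => bz zc.
have {zb} zb : X b < z by rewrite lt_neqAle bz andbT eq_sym; apply/eqP.
have [ll Lbd] := l_line Hbd; have [_ Lac] := l_line Hac; have [_ Lad] := l_line Had.
have [b0 _] := arc_endpoints D_drawing Hbd.
have [||| C [cC Cb Cl Cinf Carc]] := @pseudoline_ray R (l (b, d)) (Defs.arc D (b, d)) ll.
- exact: (arc_continuous D_drawing Hbd).
- by move=> t u t01 u01; apply: (arc_simple D_drawing Hbd); rewrite inE.
- exact: Lbd.
rewrite b0 /= in Cb Carc.
(* [H] follows ac up to its crossing with bd, and bd from there on.  The ray
   of the pseudoline bd that ends in [v_b] starts between [H] and ad but can
   meet neither of them. *)
pose H x := F1 (Num.min x z) + F2 (Num.max x z) - F1 z.
have cH : continuous H.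
  move=> x; apply: cvgB; last exact: cvg_cst.
  apply: cvgD.
    apply: (@continuous_comp _ _ _ (fun x => Num.min x z) F1); last exact: cF1.
    by apply: (@continuous_min R R id (fun=> z)); [|exact: cst_continuous].
  apply: (@continuous_comp _ _ _ (fun x => Num.max x z) F2); last exact: cF2.
  by apply: (@continuous_max R R id (fun=> z)); [|exact: cst_continuous].
have Hl x : x <= z -> H x = F1 x.
  by move=> xz; rewrite /H (min_idPl xz) (max_idPr xz) Fz addrK.
have Hr x : z <= x -> H x = F2 x.
  by move=> zx; rewrite /H (min_idPr zx) (max_idPl zx) addrC addKr.
(* The pseudoline of bd meets ad only at d and ac only at the crossing. Both points lie on the arc
   bd, as does the right part of [H], and the ray shares only the vertex b with that arc. *)
have avoid p : C p -> X a <= p.1 <= X d -> p.2 <> F0 p.1 /\ p.2 <> H p.1.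
  move=> Cp /andP[ap pd]; split=> pE.
    have p0 : edge_set D (a, d) p by apply/F0E; rewrite ap pd.
    have ne : (b, d) <> (a, d) by case=> ba; move: ab; rewrite ba ltnn.
    have [[_ Ebd] [_ Ead]] := (edge_ends Hbd, edge_ends Had).
    have pvd := lines_meet_once Hbd Had ne (Cl _ Cp) (Lad _ p0) (Lbd _ Ebd) (Lad _ Ead).
    rewrite pvd /= in Cp; have := Carc _ Cp Ebd => /(congr1 fst) /= dE.
    by move: (lt_trans Xbc Xcd); rewrite /X dE ltxx.
  have [pz|zp] := leP p.1 z.
    rewrite Hl // in pE.
    have p1 : edge_set D (a, c) p by apply/F1E; rewrite ap (le_trans pz zc).
    have ne : (b, d) <> (a, c) by case=> ba; move: ab; rewrite ba ltnn.
    have pP := lines_meet_once Hbd Hac ne (Cl _ Cp) (Lac _ p1) (Lbd _ z2) (Lac _ z1).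
    rewrite pP in Cp; have /(congr1 fst) /= zE := Carc _ Cp z2.
    by move: zb; rewrite zE ltxx.
  rewrite Hr ?ltW // in pE.
  have p2 : edge_set D (b, d) p by apply/F2E; rewrite pd (le_trans bz (ltW zp)).
  have pb := Carc _ Cp p2.
  by move: (lt_trans zb zp); rewrite pb ltxx.
have Xad : X a <= X d by rewrite !ltW // (lt_trans Xab) // (lt_trans Xbc).
have Ha : F0 (X a) = H (X a) by rewrite Hl -?F0a // (le_trans (ltW Xab)).
have Hd : F0 (X d) = H (X d) by rewrite Hr -?F0d // (le_trans zc) // ltW.
have Hb : H (X b) = F1 (X b) by rewrite Hl.
have bin : X a < (vertex D b).1 < X d by rewrite Xab (lt_trans Xbc).
move: S1 S0; case: (signature D a b c) => S1; case: (signature D a b d) => // S0; exfalso.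
  have [|p Cp [pin]] := unbounded_escapes cF0 cH Xad Ha Hd cC Cinf Cb bin.
    by rewrite -/(X b) Hb S0.
  by have [? ?] := avoid _ Cp pin; case.
have [|p Cp [pin]] := unbounded_escapes cH cF0 Xad (esym Ha) (esym Hd) cC Cinf Cb bin.
  by rewrite -/(X b) Hb S1.
by have [? ?] := avoid _ Cp pin; case.
Qed.

End PseudolinearDrawings.

Theorem theorem4 (R : realType) (n : nat)
    (sigma : 'I_n -> 'I_n -> 'I_n -> sign) :
  (exists D : drawing_data R n,
     is_drawing D /\ x_monotone D /\ pseudolinear D /\ realizes D sigma)
  <->
  (forall a b c d : 'I_n, (a < b)%N -> (b < c)%N -> (c < d)%N ->
     has_form sigma a b c d Plus Plus Plus Plus \/
     has_form sigma a b c d Plus Plus Plus Minus \/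
     has_form sigma a b c d Plus Plus Minus Minus \/
     has_form sigma a b c d Plus Minus Minus Minus \/
     has_form sigma a b c d Minus Minus Minus Minus \/
     has_form sigma a b c d Minus Minus Minus Plus \/
     has_form sigma a b c d Minus Minus Plus Plus \/
     has_form sigma a b c d Minus Plus Plus Plus).
Proof.
split; last by move=> /admissibleP; apply: drawing_of_curves.
case=> D [D_drawing [D_mono [[l [l_line l_cross]] [D_labelled D_sigma]]]] a b c d ab bc cd.
have ac := ltn_trans ab bc; have bd := ltn_trans bc cd.
have := monotone_at_left D_drawing D_mono D_labelled l_line l_cross ab bc cd.
have := monotone_at_right D_drawing D_mono D_labelled l_line l_cross ab bc cd.
have := crossing_not_enclosed D_drawing D_mono D_labelled l_line l_cross ab bc cd.
rewrite -!D_sigma //; rewrite /has_form.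
(* The three implications rule out exactly the eight forms with more than one sign change. *)
move: (sigma a b c) (sigma a b d) (sigma a c d) (sigma b c d) => x1 x2 x3 x4.
clear; case: x1 x2 x3 x4 => -[] [] [] E1 E2 E3;
  first [by have := E1 erefl | by have := E2 erefl | by have := E3 erefl | by do ?[by left|right]].
Qed.
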